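(* Let $n\ge 2$, $a\in\mathbb{R}$ and $k\in\mathbb{N}\setminus\{0\}$. (i) (Siegel domain model) For every $u\in C^{\infty}(\mathcal{U}^{n})$, $$\prod^{k}_{j=1}\left[\varrho\partial_{\varrho\varrho}+a\partial_{\varrho}+\varrho T^{2}-\mathcal{L}_{0}-i(k+1-2j)T\right]\left(\varrho^{\frac{k-n-a}{2}}u\right)=4^{-k}\varrho^{-\frac{k+n+a}{2}}\prod^{k}_{j=1}\left[\Delta_{\mathbb{B}}+n^{2}-(a-k+2j-2)^{2}\right]u .$$ (ii) (Ball model) For every $f\in C^{\infty}(\mathbb{B}_{\mathbb{C}}^{n})$, $$\prod^{k}_{j=1}\left[\Delta'_{\frac{1-a-n}{2},\frac{1-a-n}{2}}+\frac{(k+1-2j)^{2}}{4}-\frac{k+1-2j}{2}(R-\bar{R})\right]\left[(1-|z|^{2})^{\frac{k-n-a}{2}}f\right]=4^{-k}(1-|z|^{2})^{-\frac{k+n+a}{2}}\prod^{k}_{j=1}\left[\Delta_{\mathbb{B}}+n^{2}-(a-k+2j-2)^{2}\right]f .$$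
   Context: Siegel domain model. $\mathcal{U}^{n}=\{z\in\mathbb{C}^{n}:\varrho(z)>0\}$ with $\varrho(z)=\mathrm{Im}\,z_{n}-\sum_{j=1}^{n-1}|z_{j}|^{2}$. Put $t=\mathrm{Re}\,z_n$ and use the global coordinates $(z',t,\varrho)\in\mathbb{C}^{n-1}\times\mathbb{R}\times(0,\infty)$, $z'=(z_1,\dots,z_{n-1})$, $z_j=x_j+iy_j$. In these coordinates let $X_j=\partial_{x_j}+2y_j\partial_t$, $Y_j=\partial_{y_j}-2x_j\partial_t$ ($1\le j\le n-1$), $T=\partial_t$, and $\mathcal{L}_0=-\frac14\sum_{j=1}^{n-1}(X_j^2+Y_j^2)$. On $\mathcal{U}^n$ the Laplace-Beltrami operator of the Bergman metric is $$\Delta_{\mathbb{B}}=4\varrho\left[\varrho(\partial_{\varrho\varrho}+T^{2})-\mathcal{L}_{0}-(n-1)\partial_{\varrho}\right].$$ Ball model. $\mathbb{B}_{\mathbb{C}}^{n}$ is the open unit ball of $\mathbb{C}^n$; on it $$\Delta_{\mathbb{B}}=4(1-|z|^{2})\sum_{j,k=1}^{n}(\delta_{jk}-z_j\bar z_k)\frac{\partial^2}{\partial z_j\partial\bar z_k},\quad R=\sum_{j=1}^n z_j\frac{\partial}{\partial z_j},\quad \bar R=\sum_{j=1}^n\bar z_j\frac{\partial}{\partial\bar z_j},$$ $$\Delta'_{\alpha,\beta}=\sum_{j,k=1}^{n}(\delta_{jk}-z_j\bar z_k)\frac{\partial^2}{\partial z_j\partial\bar z_k}+\alpha R+\beta\bar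 R-\alpha\beta .$$ Products of differential operators denote composition; in each product above the factors commute. *)

(* Defs.v *)
From HB Require Import structures.
From mathcomp Require Import all_boot all_order all_algebra.
From mathcomp Require Import all_classical all_reals all_analysis.
From mathcomp Require Import complex.

Set Implicit Arguments.
Unset Strict Implicit.
Unset Printing Implicit Defensive.

Import Order.TTheory GRing.Theory Num.Theory.
Import numFieldNormedType.Exports.

Local Open Scope classical_set_scope.
Local Open Scope ring_scope.
Local Open Scope complex_scope.

(* R[i] carries no normed module structure over R, so the real differential
   calculus of complex-valued functions on open subsets of C^n goes through real
   and imaginary parts, both in the source and in the target: the pair (x, y)
   stands for the point with coordinates z_j = x_j + i y_j. Functions on an open
   set are represented by total functions; their values outside of it never
   affect derivatives at its points. *)
Definition Cspace (R : realType) (n : nat) : normedModType R :=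
  ('rV[R]_n * 'rV[R]_n)%type.

Section Calculus.
Context {R : realType} {V : normedModType R}.

(* f is C^(p+1) on the open set A when it is Frechet differentiable there and
   x |-> 'd f x is C^p; the spaces V used below being finite-dimensional, the
   latter is tested on each direction v. *)
Fixpoint Cdiff_on (A : set V) (p : nat) (f : V -> R) : Prop :=
  match p with
  | 0 => forall x, A x -> {for x, continuous f}
  | p'.+1 => (forall x, A x -> differentiable f x) /\
             (forall v, Cdiff_on A p' ('D_v f))
  end.

Definition smooth_on (A : set V) (u : V -> R[i]) : Prop :=
  forall p, Cdiff_on A p (fun x => complex.Re (u x)) /\ Cdiff_on A p (fun x => complex.Im (u x)).

Definition cderive (v : V) (u : V -> R[i]) : V -> R[i] := fun x =>
  'D_v (fun w => complex.Re (u w)) x +i* 'D_v (fun w => complex.Im (u w)) x.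

Definition operator := (V -> R[i]) -> (V -> R[i]).

(* P 1 \o P 2 \o ... \o P k *)
Definition prod_op (k : nat) (P : nat -> operator) : operator :=
  \big[(fun A B : operator => A \o B)/id]_(1 <= j < k.+1) P j.

End Calculus.
Arguments operator {R} V.

Section ComplexSpace.
Context {R : realType} {n : nat}.
Local Notation Cn := (Cspace R n).

Definition coord (j : 'I_n) (z : Cn) : R[i] := z.1 0 j +i* z.2 0 j.

Definition basis_x (j : 'I_n) : Cn := (delta_mx 0 j, 0).
Definition basis_y (j : 'I_n) : Cn := (0, delta_mx 0 j).

Definition normsq (z : Cn) : R := \sum_(j < n) (z.1 0 j ^+ 2 + z.2 0 j ^+ 2).

Definition dz (j : 'I_n) : operator Cn := fun u z =>
  (cderive (basis_x j) u z - 'i%C * cderive (basis_y j) u z) / 2.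
Definition dzbar (j : 'I_n) : operator Cn := fun u z =>
  (cderive (basis_x j) u z + 'i%C * cderive (basis_y j) u z) / 2.

End ComplexSpace.

(* Siegel domain in C^n with n = m.+1: the variables z' are indexed by 'I_m
   through [lift ord_max], and z_n is the coordinate of index ord_max. *)
Section Siegel.
Context {R : realType} {m : nat}.
Local Notation Cn := (Cspace R m.+1).

Definition zprime (z : Cn) : Cspace R m :=
  (\row_j z.1 0 (lift ord_max j), \row_j z.2 0 (lift ord_max j)).
Definition tcoord (z : Cn) : R := z.1 0 ord_max.
Definition varrho (z : Cn) : R := z.2 0 ord_max - normsq (zprime z).

Definition siegel : set Cn := [set z | 0 < varrho z].

(* The global coordinates ((z', t), rho) and the inverse coordinate map,
   (z', t, rho) |-> (z', t + i (rho + |z'|^2)). *)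
Definition Scoords : normedModType R := (Cspace R m * R * R)%type.

Definition to_coords (z : Cn) : Scoords := (zprime z, tcoord z, varrho z).

Definition snoc (v : 'rV[R]_m) (c : R) : 'rV[R]_m.+1 :=
  \row_j (if unlift ord_max j is Some i then v 0 i else c).
Definition of_coords (c : Scoords) : Cn :=
  (snoc c.1.1.1 c.1.2, snoc c.1.1.2 (c.2 + normsq c.1.1)).

Lemma to_coordsK : cancel to_coords of_coords.
Proof.
move=> [x y]; rewrite /of_coords /to_coords /= /varrho subrK.
congr pair; apply/rowP => j; rewrite mxE;
  by case: unliftP => [i ->|->]; rewrite ?mxE.
Qed.

Lemma of_coordsK : cancel of_coords to_coords.
Proof.
move=> [[[x y] t] r]; rewrite /of_coords /to_coords /=.
have E v c : \row_j (snoc v c) 0 (lift ord_max j) = v.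
  by apply/rowP => j; rewrite !mxE liftK.
have Z : zprime (snoc x t, snoc y (r + normsq ((x, y) : Cspace R m))) = (x, y).
  by rewrite /zprime /= !E.
by rewrite /varrho /tcoord Z /= !mxE unlift_none addrK.
Qed.

(* Coordinate derivative, at fixed values of the other coordinates among
   (x_j, y_j, t, rho), transported to functions of z. *)
Definition coord_derive (v : Scoords) : operator Cn := fun u z =>
  cderive v (u \o of_coords) (to_coords z).

Definition dx (j : 'I_m) : operator Cn := coord_derive (basis_x j, 0, 0).
Definition dy (j : 'I_m) : operator Cn := coord_derive (basis_y j, 0, 0).
Definition T : operator Cn := coord_derive (0, 1, 0).
Definition drho : operator Cn := coord_derive (0, 0, 1).

Definition X (j : 'I_m) : operator Cn := fun u z =>
  dx j u z + 2 * ((zprime z).2 0 j)%:C * T u z.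
Definition Y (j : 'I_m) : operator Cn := fun u z =>
  dy j u z - 2 * ((zprime z).1 0 j)%:C * T u z.

Definition L0 : operator Cn := fun u z =>
  - 4^-1 * \sum_(j < m) (X j (X j u) z + Y j (Y j u) z).

Definition siegel_laplacian : operator Cn := fun u z =>
  4 * (varrho z)%:C *
  ((varrho z)%:C * (drho (drho u) z + T (T u) z) - L0 u z
   - (m.+1%:R - 1) * drho u z).

End Siegel.

Section Ball.
Context {R : realType} {n : nat}.
Local Notation Cn := (Cspace R n).

Definition ball_dom : set Cn := [set z | normsq z < 1].

(* \sum_(j, k) (delta_jk - z_j \bar z_k) d^2 / dz_j d\bar z_k *)
Definition ball_second_order : operator Cn := fun f z =>
  \sum_(j < n) \sum_(k < n)
    ((j == k)%:R - coord j z * (coord k z)^*) * dz j (dzbar k f) z.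

Definition ball_laplacian : operator Cn := fun f z =>
  4 * (1 - normsq z)%:C * ball_second_order f z.

Definition radial : operator Cn := fun f z =>
  \sum_(j < n) coord j z * dz j f z.
Definition radial_bar : operator Cn := fun f z =>
  \sum_(j < n) (coord j z)^* * dzbar j f z.

Definition Delta' (alpha beta : R[i]) : operator Cn := fun f z =>
  ball_second_order f z + alpha * radial f z + beta * radial_bar f z
  - alpha * beta * f z.

End Ball.

(* Main.v *)
(* Put rho = varrho, resp. rho = 1 - |z|^2.  Both left-hand products are
   M_{p,q+k-1} M_{p+1,q+k-2} ... M_{p+k-1,q} for a family M_{p,q} of second-order
   operators, p and q real: M_{p,q} = rho (d_rho^2 + T^2) + (p+q) d_rho - L0
   + i (p-q) T in the Siegel domain, and M_{p,q} = Delta'_{alpha,beta} with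
   alpha = (1-n)/2 - q, beta = (1-n)/2 - p in the ball.  In both models
     M_{p+x,q+1} M_{p,q} = M_{p,q+1} M_{p+x,q},
     M_{p,q} rho^s = rho^s (M_{p+s,q+s} + s (s-1+p+q) rho^-1),
     Delta_B = 4 rho M_{(1-n)/2,(1-n)/2}.
   By the first relation M_{p+k,q+k}, pushed from the left through the k-fold
   product, turns it into the (k+1)-fold one; so the k-fold product equals
   M_{p+k-1,q+k-1} ... M_{p+1,q+1} M_{p,q}.  Here p = q, and by the second relation
   each M_{p+i,p+i} applied to rho^(s-i) v gives rho^(s-i-1)/4 times a translate
   of Delta_B applied to v. *)

Require Import Defs.
From HB Require Import structures.
From mathcomp Require Import all_boot all_order all_algebra.
From mathcomp Require Import all_classical all_reals all_analysis.
From mathcomp Require Import complex.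
From mathcomp Require Import ring lra.

Set Implicit Arguments.
Unset Strict Implicit.
Unset Printing Implicit Defensive.

Import Order.TTheory GRing.Theory Num.Theory.
Import numFieldNormedType.Exports.

Local Open Scope classical_set_scope.
Local Open Scope ring_scope.
Local Open Scope complex_scope.

(** * Operator identities *)

(** The exchange relation rests on a first-order operator: M_{p+x,q} - M_{p,q} = x E_q, where E_q =
    d_rho + iT in the Siegel domain and E_q = alpha - Rbar, alpha = (1-n)/2 - q, in the ball. Since
    E_{q+1} M_{p,q} = M_{p,q+1} E_q, both sides of the relation equal M_{p,q+1} (M_{p,q} + x E_q).
    The reordering is indispensable: a factor with p different from q carries a multiple of T, resp.
    of R - Rbar, which no translate of Delta_B has. The exponent s = (k-n-a)/2 is the one with p + s
    = (1-n)/2 for p = (a-k+1)/2. Each balanced factor raises p by one and lowers the exponent by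
    one, so this sum never changes. On the analytic side, the operators act on total functions that
    are controlled only on the domain, and partial derivatives commute only on smooth functions. The
    algebra is therefore carried out in an abstract commutative ring with derivations; the calculus
    has to supply one such ring for each domain, containing all real powers of rho. *)

Section Composition.
Variable E : Type.
Implicit Types (F G : nat -> E -> E) (m n : nat).

Definition comp_range F m n : E -> E :=
  \big[(fun A B : E -> E => A \o B)/id]_(m <= j < n) F j.

Lemma comp_range0 F m : comp_range F m m = id.
Proof. by rewrite /comp_range big_geq. Qed.

Lemma comp_range_recl F n :
  comp_range F 0 n.+1 = F 0%N \o comp_range (fun j => F j.+1) 0 n.
Proof. by rewrite /comp_range big_ltn // big_add1. Qed.

(** [comp_range] puts index 0 outermost, whereas the induction of [comp_range_pw] produces its
    newest factor outermost; commutation reconciles the two orders. *)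
Lemma comp_range_rev F n : (forall i j, F i \o F j = F j \o F i) ->
  F n \o comp_range F 0 n = comp_range F 0 n.+1.
Proof.
elim: n F => [|n IH] F FC; first by rewrite comp_range_recl !comp_range0.
rewrite [in LHS]comp_range_recl [in RHS]comp_range_recl -IH //.
by rewrite compA FC.
Qed.

End Composition.

(** * Factorization in an abstract commutative ring *)

Section Factorization.
Variables (R : realFieldType) (K : comPzRingType) (emb : {rmorphism R -> K}).
Variables (pw : R -> K) (M : R -> R -> K -> K).
Hypothesis pwD : forall s t, pw (s + t) = pw s * pw t.
Hypothesis MD : forall p q f g, M p q (f + g) = M p q f + M p q g.
Hypothesis MZ : forall p q c f, M p q (emb c * f) = emb c * M p q f.
Hypothesis M_exchange : forall p q x f,
  M (p + x) (q + 1) (M p q f) = M p (q + 1) (M (p + x) q f).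
Hypothesis M_pw : forall p q s f, M p q (pw s * f) =
  pw s * (M (p + s) (q + s) f + emb (s * (s - 1 + p + q)) * (pw (- 1) * f)).

(** At each crossing the travelling factor keeps its first index and loses one from its second,
    while the crossed factor gains one in its second. Peeling off the leftmost factor leaves the
    same statement at [p + 1] and [q], so the induction generalizes both. *)
Lemma comp_range_exchange p q k :
  M (p + k%:R) (q + k%:R) \o
    comp_range (fun j => M (p + j%:R) (q + k%:R - 1 - j%:R)) 0 k =
  comp_range (fun j => M (p + j%:R) (q + k%:R - j%:R)) 0 k.+1.
Proof.
elim: k p q => [|k IH] p q; first by rewrite comp_range_recl !comp_range0 subr0.
rewrite comp_range_recl [RHS]comp_range_recl; apply/funext => f /=.
rewrite !addr0 !subr0.
have -> : q + k.+1%:R = (q + k%:R) + 1 by rewrite -natr1 addrA.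
(* The exchange is used with x = k + 1, the gap between the first indices of the travelling factor
   and of the leftmost one. *)
rewrite addrK M_exchange; congr M.
have := congr1 (@^~ f) (IH (p + 1) q); rewrite /=.
have -> : p + 1 + k%:R = p + k.+1%:R by rewrite -natr1; ring.
have eqF F G : F = G -> comp_range F = comp_range G by move=> ->.
rewrite (eqF _ _ (fun j => M (p + j.+1%:R) (q + k%:R - j.+1%:R))); last first.
  by apply/funext => j; congr M; rewrite -natr1; ring.
rewrite (eqF _ (fun j => M (p + 1 + j%:R) _)
  (fun j => M (p + j.+1%:R) (q + k%:R + 1 - j.+1%:R))) //.
by apply/funext => j; congr M; rewrite -natr1; ring.
Qed.

Variable kap : R.

(** [pw 1] plays the role of rho and [kap] that of (1-n)/2, so the first term is Delta_B. *)
Definition shifted_laplacian c f := 4 * (pw 1 * M kap kap f) + emb c * f.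

Lemma shifted_laplacianC c d : shifted_laplacian c \o shifted_laplacian d =
  shifted_laplacian d \o shifted_laplacian c.
Proof.
apply/funext => f; rewrite /= /shifted_laplacian !MD !MZ.
have E g : M kap kap (4 * g) = 4 * M kap kap g.
  by rewrite -(rmorph_nat emb 4) MZ.
by rewrite !E; ring.
Qed.

(** Conjugation by rho^s moves the parameters (p, p) to ([kap], [kap]) and leaves a zeroth-order
    term in rho^-1. Extracting rho^-1 / 4 turns the sum into Delta_B plus a constant; hence every
    factor costs one power of rho and one 4. *)
Lemma M_shifted_laplacian p s f : p + s = kap -> M p p (pw s * f) =
  emb 4^-1 * (pw (s - 1) * shifted_laplacian (4 * (s * (s - 1 + p + p))) f).
Proof.
move=> ps; rewrite M_pw ps /shifted_laplacian pwD.
have one : pw (-1) * pw 1 * pw s = pw s by rewrite -!pwD; congr pw; ring.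
have e4 : emb 4^-1 * 4 = 1.
  by rewrite -(rmorph_nat emb 4) -rmorphM mulVf ?rmorph1 // pnatr_eq0.
rewrite [emb (4 * _)]rmorphM rmorph_nat.
transitivity ((emb 4^-1 * 4) * (pw (-1) * pw 1 * pw s * M kap kap f +
   pw s * (emb (s * (s - 1 + p + p)) * (pw (-1) * f)))); last by ring.
by rewrite e4 one; ring.
Qed.

Lemma comp_range_pw h s k f : h + s = kap ->
  comp_range (fun j => M (h + j%:R) (h + k%:R - 1 - j%:R)) 0 k (pw s * f) =
  emb (4 ^- k) * (pw (s - k%:R) *
    comp_range (fun j => shifted_laplacian (4 * ((s - j%:R) * (s + j%:R - 1 + h + h)))) 0 k f).
Proof.
move=> hs; elim: k => [|k IH].
  by rewrite !comp_range0 expr0 invr1 rmorph1 mul1r subr0.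
have eqF (F G : nat -> K -> K) : F = G -> comp_range F = comp_range G by move=> ->.
rewrite (eqF _ (fun j => M (h + j%:R) (h + k%:R - j%:R))); last first.
  by apply/funext => j; congr M; rewrite -natr1; ring.
(* The balanced factor now on the left has p = h + k and meets the exponent s - k, whose sum is
   again h + s = [kap]. *)
rewrite -comp_range_exchange /= IH MZ M_shifted_laplacian; last by rewrite -hs; ring.
rewrite -comp_range_rev /=; last by move=> i j; exact: shifted_laplacianC.
rewrite exprS invfM rmorphM.
have -> : s - k%:R - 1 + (h + k%:R) + (h + k%:R) = s + k%:R - 1 + h + h by ring.
have -> : s - k%:R - 1 = s - k.+1%:R by rewrite -natr1; ring.
by ring.
Qed.

Theorem factorization (n a : R) k f : kap = (1 - n) / 2 ->
  comp_range (fun j => M ((a - (k%:R + 1 - 2 * j%:R)) / 2)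
                         ((a + (k%:R + 1 - 2 * j%:R)) / 2)) 1 k.+1
    (pw ((k%:R - n - a) / 2) * f) =
  emb (4 ^- k) * (pw (- ((k%:R + n + a) / 2)) *
    comp_range (fun j => shifted_laplacian (n ^+ 2 - (a - k%:R + 2 * j%:R - 2) ^+ 2)) 1 k.+1 f).
Proof.
(* [h] is the first index of the factor j = 1. The shift 4 (s - j) (s + j - 1 + 2h) factors as n^2 -
   (a - k + 2j)^2, and passing from indices starting at 0 to indices starting at 1 produces the -2
   of the statement. *)
move=> kapE; pose h := (a - k%:R + 1) / 2; pose s := (k%:R - n - a) / 2.
have := @comp_range_pw h s k f; rewrite /comp_range !big_add1 /= => H.
have -> : - ((k%:R + n + a) / 2) = s - k%:R by rewrite /s; field.
have jS (j : nat) : j.+1%:R = j%:R + 1 :> R by rewrite natr1.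
rewrite (eq_bigr (fun j => M (h + j%:R) (h + k%:R - 1 - j%:R))); last first.
  by move=> j _; rewrite jS /h; congr M; field.
rewrite -/s H; last by rewrite kapE /h /s; field.
congr (_ * (_ * _)); rewrite (eq_bigr (fun j =>
  shifted_laplacian (n ^+ 2 - (a - k%:R + 2 * j.+1%:R - 2) ^+ 2))) // => j _.
by rewrite jS /h /s; congr shifted_laplacian; field.
Qed.

End Factorization.

(** Only additivity and the Leibniz rule are recorded, as [K] carries no scalar action; linearity
    over constants follows once the image of [emb] is annihilated. *)
Record derivation (K : pzRingType) (D : K -> K) : Prop := Derivation {
  derivationD : forall f g, D (f + g) = D f + D g;
  derivationM : forall f g, D (f * g) = D f * g + f * D g }.

Section DerivationTheory.
Variables (K : pzRingType) (D : K -> K).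
Hypothesis dD : derivation D.

Lemma derivation0 : D 0 = 0.
Proof. by apply: (addrI (D 0)); rewrite -(derivationD dD) !addr0. Qed.

Lemma derivationN f : D (- f) = - D f.
Proof. by apply: (addrI (D f)); rewrite -(derivationD dD) !subrr derivation0. Qed.

Lemma derivation1 : D 1 = 0.
Proof.
by apply: (addrI (D 1)); rewrite addr0 -{3}[1]mulr1 (derivationM dD) mulr1 mul1r.
Qed.

Lemma derivation_sum (J : Type) (r : seq J) (P : pred J) (F : J -> K) :
  D (\sum_(j <- r | P j) F j) = \sum_(j <- r | P j) D (F j).
Proof. exact: (big_morph D (derivationD dD) derivation0). Qed.

End DerivationTheory.

(** * The Siegel family in a commutative ring with commuting derivations *)

Section SiegelAlgebra.
Variables (R : realFieldType) (K : comPzRingType) (emb : {rmorphism R -> K}).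
Variables (pw : R -> K) (I : K) (d T L : K -> K).
Hypothesis pwD : forall s t, pw (s + t) = pw s * pw t.
Hypothesis I2 : I * I = -1.
Hypotheses (dd : derivation d) (dT : derivation T).
Hypothesis Td : forall f, T (d f) = d (T f).
Hypothesis LD : forall f g, L (f + g) = L f + L g.
Hypothesis LI : forall f, L (I * f) = I * L f.
Hypothesis Lemb : forall c f, L (emb c * f) = emb c * L f.
Hypothesis Lpw : forall s f, L (pw s * f) = pw s * L f.
Hypotheses (Ld : forall f, L (d f) = d (L f)) (LT : forall f, L (T f) = T (L f)).
Hypotheses (demb : forall c, d (emb c) = 0) (Temb : forall c, T (emb c) = 0).
Hypotheses (dI : d I = 0) (TI : T I = 0).
Hypothesis dpw : forall s, d (pw s) = emb s * pw (s - 1).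
Hypothesis Tpw : forall s, T (pw s) = 0.
Hypothesis pw0 : pw 0 = 1.

Definition siegelM p q f :=
  pw 1 * d (d f) + emb (p + q) * d f + pw 1 * T (T f) - L f
  + I * emb (p - q) * T f.

Let dpw1 : d (pw 1) = 1.
Proof. by rewrite dpw rmorph1 subrr pw0 mulr1. Qed.

Let dE := (derivationD dd, derivationM dd, derivationN dd, derivation0 dd, demb, dI, dpw1).
Let TE := (derivationD dT, derivationM dT, derivationN dT, derivation0 dT, Temb, TI, Tpw).

Lemma siegelMD p q f g : siegelM p q (f + g) = siegelM p q f + siegelM p q g.
Proof. by rewrite /siegelM !(LD, dE, TE); ring. Qed.

Lemma siegelMZ p q c f : siegelM p q (emb c * f) = emb c * siegelM p q f.
Proof. by rewrite /siegelM !(Lemb, dE, TE, mul0r, add0r); ring. Qed.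

Let E f := d f + I * T f.

(** The coefficient rho satisfies [E, rho] = 1, which contributes d_rho^2 + T^2 = (d_rho - iT) E.
    The operator d_rho - iT is exactly the change of [siegelM] when q grows by one. *)
Let E_siegelM p q f : E (siegelM p q f) = siegelM p (q + 1) (E f).
Proof.
rewrite /E /siegelM !(LD, LI, dE, TE) !Ld !LT !Td.
rewrite !(mul0r, add0r, addr0, mulr0) !rmorphB !rmorphD rmorph1.
ring: I2.
Qed.

Lemma siegelM_exchange p q x f :
  siegelM (p + x) (q + 1) (siegelM p q f) = siegelM p (q + 1) (siegelM (p + x) q f).
Proof.
have shift p' q' g : siegelM (p' + x) q' g = siegelM p' q' g + emb x * E g.
  by rewrite /siegelM /E !rmorphB !rmorphD; ring.
by rewrite !shift [in RHS](siegelMD _ _ _ (emb x * _)) siegelMZ E_siegelM.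
Qed.

(** Both L and T treat rho^s as a constant, so only the d_rho terms react: the cross term 2s d_rho
    raises p + q by 2s and leaves p - q alone, and s (s - 1) + s (p + q) remains in order zero. *)
Lemma siegelM_pw p q s f : siegelM p q (pw s * f) =
  pw s * (siegelM (p + s) (q + s) f + emb (s * (s - 1 + p + q)) * (pw (- 1) * f)).
Proof.
have pwN t : pw (t - 1) = pw t * pw (-1) by rewrite pwD.
have pw1N : pw 1 * pw (-1) = 1 by rewrite -pwD subrr.
rewrite /siegelM Lpw !(dE, TE, dpw) !pwN.
rewrite !(mul0r, add0r, addr0, mulr0) !(rmorphB, rmorphD, rmorphM, rmorph1).
ring: pw1N.
Qed.

End SiegelAlgebra.

Lemma sum_delta (K : pzRingType) (n : nat) (F : 'I_n -> K) k :
  \sum_j (j == k)%:R * F j = F k.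
Proof.
rewrite (bigD1 k) //= eqxx mul1r big1 ?addr0 // => j /negbTE->.
by rewrite mul0r.
Qed.

(** * The ball family in a commutative ring with derivations d_j and dbar_j *)

Section BallAlgebra.
Variables (R : realFieldType) (K : comPzRingType) (emb : {rmorphism R -> K}).
Variables (pw : R -> K) (n : nat) (z zb : 'I_n -> K) (d db : 'I_n -> K -> K).
Hypothesis pwD : forall s t, pw (s + t) = pw s * pw t.
Hypothesis pw0 : pw 0 = 1.
Hypothesis pw1 : pw 1 = 1 - \sum_j z j * zb j.
Hypotheses (dd : forall j, derivation (d j)) (ddb : forall j, derivation (db j)).
Hypothesis dbC : forall j k f, db j (db k f) = db k (db j f).
Hypothesis ddbC : forall j k f, db j (d k f) = d k (db j f).
Hypothesis demb : forall j c, d j (emb c) = 0.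
Hypothesis dbemb : forall j c, db j (emb c) = 0.
Hypothesis dz : forall j k, d j (z k) = (j == k)%:R.
Hypothesis dzb : forall j k, d j (zb k) = 0.
Hypothesis dbz : forall j k, db j (z k) = 0.
Hypothesis dbzb : forall j k, db j (zb k) = (j == k)%:R.
Hypothesis dpw : forall j s, d j (pw s) = - (emb s * pw (s - 1) * zb j).
Hypothesis dbpw : forall j s, db j (pw s) = - (emb s * pw (s - 1) * z j).

Definition euler f := \sum_j z j * d j f.
Definition eulerb f := \sum_j zb j * db j f.
Definition flat_laplacian f := \sum_j d j (db j f).

Definition ballM p q f :=
  flat_laplacian f - euler (eulerb f) + emb ((1 - n%:R) / 2 - q) * euler f
  + emb ((1 - n%:R) / 2 - p) * eulerb f
  - emb (((1 - n%:R) / 2 - q) * ((1 - n%:R) / 2 - p)) * f.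

Let derivation_euler : derivation euler.
Proof.
split=> f g.
  by rewrite -big_split; apply: eq_bigr => j _; rewrite (derivationD (dd j)) mulrDr.
rewrite mulr_suml mulr_sumr -big_split; apply: eq_bigr => j _ /=.
by rewrite (derivationM (dd j)); ring.
Qed.

Let derivation_eulerb : derivation eulerb.
Proof.
split=> f g.
  by rewrite -big_split; apply: eq_bigr => j _; rewrite (derivationD (ddb j)) mulrDr.
rewrite mulr_suml mulr_sumr -big_split; apply: eq_bigr => j _ /=.
by rewrite (derivationM (ddb j)); ring.
Qed.

(** This holds because d_j annihilates every zbar_k. It makes the second-order part of Delta' equal
    to the flat Laplacian minus R Rbar, so that commutators among these three operators suffice. *)
Lemma euler_eulerb f : euler (eulerb f) = \sum_j \sum_k z j * zb k * d j (db k f).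
Proof.
apply: eq_bigr => j _; rewrite (derivation_sum (dd j)) mulr_sumr.
by apply: eq_bigr => k _; rewrite (derivationM (dd j)) dzb; ring.
Qed.

Let eulerC f : eulerb (euler f) = euler (eulerb f).
Proof.
rewrite euler_eulerb exchange_big; apply: eq_bigr => j _ /=.
rewrite (derivation_sum (ddb j)) mulr_sumr; apply: eq_bigr => k _.
by rewrite (derivationM (ddb j)) dbz ddbC; ring.
Qed.

(** Rbar counts the degree in zbar, and the flat Laplacian lowers that degree by one. *)
Let eulerb_laplacian f :
  eulerb (flat_laplacian f) = flat_laplacian (eulerb f) - flat_laplacian f.
Proof.
rewrite /flat_laplacian -sumrB (derivation_sum derivation_eulerb).
apply: eq_bigr => j _; rewrite (derivation_sum (ddb j)) (derivation_sum (dd j)).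
rewrite (eq_bigr (fun k => (k == j)%:R * d j (db k f) + zb k * db k (d j (db j f)))).
  by rewrite big_split /= sum_delta [RHS]addrC addKr.
move=> k _; rewrite (derivationM (ddb j)) dbzb (derivationD (dd j)).
rewrite !(derivationM (dd j)) dzb eq_sym ddbC dbC.
have -> : d j (k == j)%:R = 0 by rewrite -(rmorph_nat emb) demb.
by rewrite !mul0r !add0r.
Qed.

Let laplacianD f g : flat_laplacian (f + g) = flat_laplacian f + flat_laplacian g.
Proof.
rewrite -big_split; apply: eq_bigr => j _.
by rewrite (derivationD (ddb j)) (derivationD (dd j)).
Qed.

Let laplacianZ c f : flat_laplacian (emb c * f) = emb c * flat_laplacian f.
Proof.
rewrite mulr_sumr; apply: eq_bigr => j _.
by rewrite (derivationM (ddb j)) dbemb mul0r add0r (derivationM (dd j)) demb mul0r add0r.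
Qed.

Let laplacianN f : flat_laplacian (- f) = - flat_laplacian f.
Proof. by rewrite -mulN1r -(rmorph1 emb) -rmorphN laplacianZ rmorphN rmorph1 mulN1r. Qed.

Let pwN t : pw (t - 1) = pw t * pw (-1). Proof. by rewrite pwD. Qed.

Let pw1N : pw 1 * pw (-1) = 1. Proof. by rewrite -pwD subrr. Qed.

Let euler_emb c : euler (emb c) = 0.
Proof. by rewrite /euler big1 // => j _; rewrite demb mulr0. Qed.

Let eulerb_emb c : eulerb (emb c) = 0.
Proof. by rewrite /eulerb big1 // => j _; rewrite dbemb mulr0. Qed.

Let normE : \sum_j z j * zb j = 1 - pw 1. Proof. by rewrite pw1; ring. Qed.

Let euler_pw s : euler (pw s) = emb s * (pw s - pw s * pw (-1)).
Proof.
transitivity (- (emb s * pw (s - 1) * \sum_j z j * zb j)).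
  by rewrite mulr_sumr -sumrN; apply: eq_bigr => j _; rewrite dpw; ring.
by rewrite normE pwN; ring: pw1N.
Qed.

Let eulerb_pw s : eulerb (pw s) = emb s * (pw s - pw s * pw (-1)).
Proof.
transitivity (- (emb s * pw (s - 1) * \sum_j z j * zb j)).
  by rewrite mulr_sumr -sumrN; apply: eq_bigr => j _; rewrite dbpw; ring.
by rewrite normE pwN; ring: pw1N.
Qed.

Let laplacian_pw s f : flat_laplacian (pw s * f) = pw s * flat_laplacian f
  - emb s * pw s * pw (-1) * (euler f + eulerb f)
  + (emb (s * (s - 1)) * pw s * pw (-1) * pw (-1) * (1 - pw 1)
     - emb (s * n%:R) * pw s * pw (-1)) * f.
Proof.
rewrite -normE /flat_laplacian /euler /eulerb.
(* The dimension enters as the sum over j of d_j z_j = 1; spreading it over the indices lets the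
   identity be checked term by term. *)
have -> : emb (s * n%:R) = \sum_(j < n) emb s.
  by rewrite sumr_const card_ord rmorphM rmorph_nat mulr_natr.
rewrite -big_split !mulr_sumr !mulr_suml -!sumrB mulr_suml -big_split /=.
apply: eq_bigr => j _.
rewrite (derivationM (ddb j)) dbpw (derivationD (dd j)) !(derivationM (dd j)).
rewrite (derivationN (dd j)) !(derivationM (dd j)) !dpw demb dz eqxx !pwN.
by rewrite !(rmorphM, rmorphB, rmorph1); ring.
Qed.

Let RE := (derivationD derivation_euler, derivationM derivation_euler,
  derivationN derivation_euler, derivation0 derivation_euler, euler_emb, euler_pw).
Let RbE := (derivationD derivation_eulerb, derivationM derivation_eulerb,
  derivationN derivation_eulerb, derivation0 derivation_eulerb, eulerb_emb, eulerb_pw).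

Lemma ballMD p q f g : ballM p q (f + g) = ballM p q f + ballM p q g.
Proof. by rewrite /ballM !(laplacianD, RE, RbE); ring. Qed.

Lemma ballMZ p q c f : ballM p q (emb c * f) = emb c * ballM p q f.
Proof. by rewrite /ballM !(laplacianZ, RE, RbE, mul0r, add0r); ring. Qed.

(** Write [ballM p q] as flat - (R - beta) (Rbar - alpha), with flat the flat Laplacian. Raising q
    by one replaces alpha by alpha - 1, and the degree count gives (Rbar - alpha + 1) flat = flat
    (Rbar - alpha), while R and Rbar commute. *)
Let shift_eulerb p q f :
  eulerb (ballM p q f) - emb ((1 - n%:R) / 2 - q - 1) * ballM p q f =
  ballM p (q + 1) (eulerb f - emb ((1 - n%:R) / 2 - q) * f).
Proof.
rewrite /ballM !(RE, RbE, laplacianD, laplacianN, laplacianZ).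
rewrite eulerb_laplacian !eulerC !(mul0r, add0r).
by rewrite !(rmorphB, rmorphD, rmorphM, rmorph1); ring.
Qed.

Lemma ballM_exchange p q x f :
  ballM (p + x) (q + 1) (ballM p q f) = ballM p (q + 1) (ballM (p + x) q f).
Proof.
have shift p' q' g : ballM (p' + x) q' g =
    ballM p' q' g + emb (- x) * (eulerb g - emb ((1 - n%:R) / 2 - q') * g).
  by rewrite /ballM !(rmorphB, rmorphD, rmorphM, rmorph1, rmorphN); ring.
rewrite !shift [in RHS](ballMD _ _ _ (emb (- x) * _)) ballMZ -shift_eulerb.
by congr (_ + _ * (_ - emb _ * _)); ring.
Qed.

Lemma ballM_pw p q s f : ballM p q (pw s * f) =
  pw s * (ballM (p + s) (q + s) f + emb (s * (s - 1 + p + q)) * (pw (- 1) * f)).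
Proof.
rewrite /ballM laplacian_pw !(RE, RbE).
have n2 : emb (n%:R) = emb ((1 - n%:R) / 2) * - 2 + 1.
  by rewrite -(rmorph_nat emb 2) -rmorphN -rmorphM -(rmorph1 emb) -rmorphD; congr (emb _); field.
(* The dimension is expressed through c = (1 - n) / 2, so that a single free constant remains and no
   division takes place in [K]. *)
have h2 : s * n%:R = s * (((1 - n%:R) / 2) * - 2 + 1) by field.
rewrite h2; move: ((1 - n%:R) / 2) => c {n2 h2}.
rewrite !(rmorphB, rmorphD, rmorphM, rmorph1, rmorphN, rmorph_nat, mul0r, add0r).
ring: pw1N.
Qed.

End BallAlgebra.

(** * Calculus of smooth functions *)

Section RealCalculus.
Context {R : realType} {V : normedModType R}.
Variable A : set V.
Hypothesis Aop : open A.
Implicit Types (f g : V -> R) (v w : V).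

Lemma open_near_eq (W : Type) (f g : V -> W) x :
  (forall y, A y -> f y = g y) -> A x -> \forall y \near x, f y = g y.
Proof.
move=> fg Ax; have := open_nbhs_nbhs (conj Aop Ax).
by apply: filterS => y; exact: fg.
Qed.

Lemma derive_eq_on f g v x :
  (forall y, A y -> f y = g y) -> A x -> 'D_v f x = 'D_v g x.
Proof. by move=> fg Ax; apply: near_eq_derive; exact: open_near_eq. Qed.

(** The difference g - f vanishes near x, so the zero map is its differential there; adding it to f
    transfers differentiability. *)
Lemma differentiable_eq_on f g x : (forall y, A y -> f y = g y) -> A x ->
  differentiable f x -> differentiable g x.
Proof.
move=> fg Ax df; pose e : V -> R := g - f.
have e0 : \forall y \near x, e y = 0.
  by apply: (@open_near_eq _ e (fun=> 0)) => // y Ay; rewrite /e !fctE fg // subrr.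
have -> : g = f + e by rewrite /e addrC subrK.
apply: differentiableD => //; pose z : {linear V -> R} := \0.
have zc : continuous z by exact: cst_continuous.
have eo : e \o shift x = cst (e x) + z +o_ 0 id.
  apply/eqaddoP => eps eps0; have := e0; rewrite (near_shift 0 x) subr0.
  apply: filterS => h /= eh; rewrite !fctE /= eh (nbhs_singleton e0) /z /=.
  by rewrite !(addr0, subrr) normr0 mulr_ge0 // ltW.
have de : 'd e x = z :> (V -> R) by exact: diff_unique.
by apply/diff_locallyP; rewrite de.
Qed.

Lemma Cdiff_on_eq p f g : (forall x, A x -> f x = g x) ->
  Cdiff_on A p f -> Cdiff_on A p g.
Proof.
elim: p f g => [|p IH] f g fg /=.
  move=> fc x Ax; change (g @ x --> g x); rewrite -(fg x Ax).
  by apply: cvg_trans (fc x Ax); apply: near_eq_cvg; exact: open_near_eq.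
case=> df Df; split=> [x Ax|v]; first exact: differentiable_eq_on (df x Ax).
by apply: IH (Df v) => x Ax; exact: derive_eq_on.
Qed.

Lemma Cdiff_onW p f : Cdiff_on A p.+1 f -> Cdiff_on A p f.
Proof.
elim: p f => [|p IH] f [df Df].
  by move=> x /df /differentiable_continuous.
by split=> // v; apply: IH; exact: Df.
Qed.

Lemma Cdiff_on_cst p (c : R) : Cdiff_on A p (fun=> c).
Proof.
elim: p c => [|p IH] c /=; first by move=> x _; exact: cvg_cst.
split=> [x _|v]; first exact: differentiable_cst.
by apply: Cdiff_on_eq (IH 0) => x _; rewrite derive_cst.
Qed.

Lemma Cdiff_onD p f g : Cdiff_on A p f -> Cdiff_on A p g ->
  Cdiff_on A p (fun x => f x + g x).
Proof.
elim: p f g => [|p IH] f g.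
  by move=> cf cg x Ax; apply: cvgD; [exact: cf|exact: cg].
move=> [df Df] [dg Dg]; split=> [x Ax|v].
  by apply: differentiableD; [exact: df|exact: dg].
apply: Cdiff_on_eq (IH _ _ (Df v) (Dg v)) => x Ax.
by rewrite -deriveD //; apply: diff_derivable; [exact: df|exact: dg].
Qed.

Lemma Cdiff_onM p f g : Cdiff_on A p f -> Cdiff_on A p g ->
  Cdiff_on A p (fun x => f x * g x).
Proof.
elim: p f g => [|p IH] f g.
  by move=> cf cg x Ax; apply: cvgM; [exact: cf|exact: cg].
move=> fC gC; have [df Df] := fC; have [dg Dg] := gC; split=> [x Ax|v].
  by apply: differentiableM; [exact: df|exact: dg].
apply: Cdiff_on_eq
  (Cdiff_onD (IH _ _ (Cdiff_onW fC) (Dg v)) (IH _ _ (Cdiff_onW gC) (Df v))) => x Ax.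
by rewrite -deriveM //; apply: diff_derivable; [exact: df|exact: dg].
Qed.

Lemma differentiable_powR f s x : 0 < f x -> differentiable f x ->
  differentiable (fun y => f y `^ s) x.
Proof.
move=> fx0 df; apply: (@differentiable_comp _ _ _ _ f (@powR R ^~ s)) => //.
by apply/derivable1_diffP; have [] := is_derive1_powR s fx0.
Qed.

Lemma derive_powR f s v x : 0 < f x -> differentiable f x ->
  'D_v (fun y => f y `^ s) x = s * f x `^ (s - 1) * 'D_v f x.
Proof.
move=> fx0 df; have dp : differentiable (@powR R ^~ s) (f x).
  by apply/derivable1_diffP; have [] := is_derive1_powR s fx0.
rewrite deriveE; last exact: differentiable_powR.
rewrite (@diff_comp _ _ _ _ f (@powR R ^~ s)) //= deriveE // diff1E // derive1E.
by have [_ ->] := is_derive1_powR s fx0; exact: mulrC.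
Qed.

(** The exponent varies in the induction, since differentiation turns s into s - 1. *)
Lemma Cdiff_on_powR p f s : (forall x, A x -> 0 < f x) -> Cdiff_on A p f ->
  Cdiff_on A p (fun x => f x `^ s).
Proof.
move=> f0; elim: p s => [|p IH] s fC.
  move=> x Ax; apply: (@continuous_comp _ _ _ f (@powR R ^~ s)); first exact: fC.
  apply/differentiable_continuous/derivable1_diffP.
  by have [] := is_derive1_powR s (f0 x Ax).
have [df Df] := fC; split=> [x Ax|v].
  by apply: differentiable_powR; [exact: f0|exact: df].
apply: (@Cdiff_on_eq _ (fun x => s * f x `^ (s - 1) * 'D_v f x)) => [x Ax|].
  by rewrite derive_powR //; [exact: f0|exact: df].
apply: Cdiff_onM (Df v); apply: Cdiff_onM; first exact: Cdiff_on_cst.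
exact/IH/Cdiff_onW.
Qed.

Lemma is_derive_line f y v (s : R) : derivable f (y + s *: v) v ->
  is_derive s 1 (fun t : R => f (y + t *: v)) ('D_v f (y + s *: v)).
Proof.
have E : (fun h : R => h^-1 *: (((fun t : R => f (y + t *: v)) \o shift s) (h *: 1) -
    f (y + s *: v))) =
  (fun h => h^-1 *: ((f \o shift (y + s *: v)) (h *: v) - f (y + s *: v))).
  apply/funext => h /=; congr (_ *: (f _ - _)).
  by rewrite [_ *: 1]mulr1 scalerDl addrCA.
by move=> df; split; rewrite /derivable /derive E.
Qed.

(** The mean value theorem is applied twice: along v to f(. + hw) - f, then along w to the
    v-derivative of f at the intermediate point found. *)
Lemma second_difference f v w x (h : R) : 0 < h ->
  (forall s t, 0 <= s <= h -> 0 <= t <= h -> A (x + s *: v + t *: w)) ->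
  (forall y, A y -> differentiable f y) ->
  (forall y, A y -> differentiable ('D_v f) y) ->
  exists c d, [/\ 0 <= c <= h, 0 <= d <= h &
   f (x + h *: v + h *: w) - f (x + h *: v) - f (x + h *: w) + f x =
   h * h * 'D_w ('D_v f) (x + c *: v + d *: w)].
Proof.
move=> h0 sq df dDf; have h0' := ltW h0.
have itvP' (s : R) : s \in `]0, h[ -> 0 <= s <= h.
  by rewrite in_itv /= => /andP[s0 sh]; rewrite !ltW.
have itvP'' (s : R) : s \in `[0, h] -> 0 <= s <= h by rewrite in_itv.
pose phi (s : R) := f (x + h *: w + s *: v) - f (x + s *: v).
pose dphi (s : R) := 'D_v f (x + h *: w + s *: v) - 'D_v f (x + s *: v).
have swap (s t : R) : x + t *: w + s *: v = x + s *: v + t *: w by rewrite addrAC.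
have sq0 s : 0 <= s <= h -> A (x + s *: v).
  by move=> sh; have := sq s 0 sh; rewrite scale0r addr0; apply; rewrite lexx.
have sqh s : 0 <= s <= h -> A (x + h *: w + s *: v).
  by move=> sh; rewrite swap; apply: sq => //; rewrite h0' lexx.
have dphiP s : 0 <= s <= h -> is_derive s 1 phi (dphi s).
  move=> sh; apply: is_deriveB; apply: is_derive_line; apply: diff_derivable.
    exact/df/sqh.
  exact/df/sq0.
have [|c /itvP' ch phiE] := @MVT R phi dphi 0 h h0 (fun s sh => dphiP s (itvP' s sh)).
  apply: derivable_within_continuous => s /itvP'' sh.
  by have [] := dphiP s sh.
have psiP t : 0 <= t <= h -> is_derive t 1 (fun t : R => 'D_v f (x + c *: v + t *: w))
    ('D_w ('D_v f) (x + c *: v + t *: w)).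
  by move=> th; apply: is_derive_line; apply: diff_derivable; exact/dDf/sq.
have [|d /itvP' dh psiE] := @MVT R _ _ 0 h h0 (fun t th => psiP t (itvP' t th)).
  apply: derivable_within_continuous => t /itvP'' th.
  by have [] := psiP t th.
exists c, d; split=> //.
move: phiE psiE; rewrite /phi /dphi !scale0r !addr0 !subr0 !swap => phiE psiE.
rewrite psiE in phiE; rewrite mulrAC -mulrA mulrC -phiE.
by ring.
Qed.

(** Schwarz's theorem. The second difference over a parallelogram is symmetric in v and w, so a
    value of one mixed derivative equals a value of the other at a second nearby point; continuity
    of both at x concludes. *)
Lemma derive_comm f v w x : A x -> Cdiff_on A 2 f ->
  'D_w ('D_v f) x = 'D_v ('D_w f) x.
Proof.
move=> Ax [df Df].
have dDf u y : A y -> differentiable ('D_u f) y by have [dD _] := Df u; exact: dD.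
have cont u u' : {for x, continuous ('D_u' ('D_u f))}.
  by have [_ DD] := Df u; exact: DD.
apply/eqP; rewrite -subr_eq0 -normr_le0; apply/ler_addgt0Pr => e e0.
rewrite add0r.
have near_x : \forall y \near x, [/\ A y,
    `|'D_w ('D_v f) x - 'D_w ('D_v f) y| < e / 2 &
    `|'D_v ('D_w f) x - 'D_v ('D_w f) y| < e / 2].
  have e20 : 0 < e / 2 by rewrite divr_gt0.
  have nA : \forall y \near x, A y by exact: open_nbhs_nbhs.
  have c1 : 'D_w ('D_v f) @ x --> 'D_w ('D_v f) x by exact: cont.
  have c2 : 'D_v ('D_w f) @ x --> 'D_v ('D_w f) x by exact: cont.
  move/cvgrPdist_lt: c1 => /(_ _ e20) c1; move/cvgrPdist_lt: c2 => /(_ _ e20) c2.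
  apply: filterS (filterI nA (filterI c1 c2)) => y [Ay [d1 d2]].
  exact: And3 Ay d1 d2.
have [r /= r0 Hr] : exists2 r : R, 0 < r & ball x r `<=` [set y | [/\ A y,
    `|'D_w ('D_v f) x - 'D_w ('D_v f) y| < e / 2 &
    `|'D_v ('D_w f) x - 'D_v ('D_w f) y| < e / 2]].
  by have /nbhs_ballP[r r0 Hr] := near_x; exists r.
(* The parallelogram with sides hv and hw has to stay in the ball of radius r: h (|v| + |w| + 1) = r
   / 2. The summand 1 keeps the divisor positive when v = w = 0. *)
pose h := r / (2 * (`|v| + `|w| + 1)).
have n0 : 0 < `|v| + `|w| + 1 by rewrite ltr_wpDl // addr_ge0.
have h0 : 0 < h by rewrite divr_gt0 // mulr_gt0.
have Hh s t : 0 <= s <= h -> 0 <= t <= h ->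
   [/\ A (x + s *: v + t *: w),
    `|'D_w ('D_v f) x - 'D_w ('D_v f) (x + s *: v + t *: w)| < e / 2 &
    `|'D_v ('D_w f) x - 'D_v ('D_w f) (x + s *: v + t *: w)| < e / 2].
  move=> /andP[s0 sh] /andP[t0 th]; apply: Hr.
  rewrite -ball_normE /ball_ /= -addrA opprD addrA subrr add0r normrN.
  apply: le_lt_trans (ler_normD _ _) _; rewrite !normrZ !ger0_norm //.
  apply: (@le_lt_trans _ _ (h * (`|v| + `|w| + 1))).
    rewrite mulrDr mulr1 mulrDr -[leLHS]addr0.
    by apply: lerD; [apply: lerD; exact: ler_wpM2r|exact: ltW].
  rewrite /h invfM mulrA mulfVK ?gt_eqF //.
  by rewrite ltr_pdivrMr // ltr_pMr // ltr1n.
have [c [d [ch dh E1]]] := @second_difference f v w x h h0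
  (fun s t sh th => let: And3 q _ _ := Hh s t sh th in q) df (dDf v).
have [|c' [d' [ch' dh' E2]]] := @second_difference f w v x h h0 _ df (dDf w).
  by move=> s t sh th; rewrite addrAC; have [] := Hh t s th sh.
have E : 'D_w ('D_v f) (x + c *: v + d *: w) = 'D_v ('D_w f) (x + d' *: v + c' *: w).
  have hh : h * h != 0 by rewrite mulf_neq0 // gt_eqF.
  apply: (mulfI hh); rewrite -E1 addrAC -[x + d' *: v + _]addrAC -E2.
  by rewrite [x + h *: w + _]addrAC; ring.
have [_ b1 _] := Hh _ _ ch dh; have [_ _ b2] := Hh _ _ dh' ch'.
rewrite E in b1; rewrite distrC in b2.
move: b1 b2; move: ('D_w ('D_v f) x) ('D_v ('D_w f) x).
move: ('D_v ('D_w f) (x + d' *: v + c' *: w)) => p3 p1 p2.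
rewrite !ltr_norml ler_norml => /andP[b1 b2] /andP[b3 b4].
clear -b1 b2 b3 b4; apply/andP; split; lra.
Qed.

End RealCalculus.

(* Smooth functions live on the subtype of A, so that agreement on A becomes
   equality in a commutative ring with commuting derivations. *)
Section SmoothFunctions.
Context {R : realType} {V : normedModType R}.
Variables (A : set V) (Aop : open A).
Implicit Types (F G : V -> R[i]) (g h : V -> R).

Lemma smooth_on_eq F G : (forall x, A x -> F x = G x) ->
  smooth_on A F -> smooth_on A G.
Proof.
move=> FG sF p; have [r i] := sF p.
by split; [apply: Cdiff_on_eq r|apply: Cdiff_on_eq i] => // x Ax; rewrite FG.
Qed.

Lemma smooth_onD F G : smooth_on A F -> smooth_on A G ->
  smooth_on A (fun x => F x + G x).
Proof.
move=> sF sG p; have [rF iF] := sF p; have [rG iG] := sG p.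
split; [apply: Cdiff_on_eq (Cdiff_onD Aop rF rG)|
  apply: Cdiff_on_eq (Cdiff_onD Aop iF iG)] => // x _.
- by case: (F x) (G x) => a b [].
- by case: (F x) (G x) => a b [].
Qed.

Lemma smooth_on_real g : (forall p, Cdiff_on A p g) ->
  smooth_on A (fun x => (g x)%:C).
Proof. by move=> sg p; split=> //; exact: Cdiff_on_cst. Qed.

Lemma smooth_on_cst (c : R[i]) : smooth_on A (fun=> c).
Proof. by move=> p; split; exact: Cdiff_on_cst. Qed.

Lemma smooth_onM F G : smooth_on A F -> smooth_on A G ->
  smooth_on A (fun x => F x * G x).
Proof.
move=> sF sG p; have [rF iF] := sF p; have [rG iG] := sG p.
split.
  apply: Cdiff_on_eq (Cdiff_onD Aop (Cdiff_onM Aop rF rG)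
    (Cdiff_onM Aop (Cdiff_on_cst Aop p (-1)) (Cdiff_onM Aop iF iG))) => // x _.
  by case: (F x) (G x) => a b [c d] /=; ring.
apply: Cdiff_on_eq
  (Cdiff_onD Aop (Cdiff_onM Aop rF iG) (Cdiff_onM Aop iF rG)) => // x _.
by case: (F x) (G x) => a b [c d] /=; ring.
Qed.

Lemma smooth_on_cderive v F : smooth_on A F -> smooth_on A (cderive v F).
Proof. by move=> sF p; have [[_ r] [_ i]] := sF p.+1; split; [exact: r|exact: i]. Qed.

(** The value 0 off [A] is a placeholder: as [A] is open, it does not affect derivatives at points
    of [A]. *)
Definition extend0 (f : A -> R[i]) : V -> R[i] :=
  fun x => if insub x is Some a then f a else 0.

Lemma extend0E (f : A -> R[i]) a : extend0 f (val a) = f a.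
Proof. by rewrite /extend0 valK. Qed.

Lemma extend0_restrict F x : A x -> extend0 (fun a : A => F (val a)) x = F x.
Proof.
move=> Ax; have xA : x \in A by exact: mem_set.
by rewrite /extend0 insubT; rewrite SubK.
Qed.

(** The openness proof is an argument so that the type built from this predicate determines it:
    closure under ring operations, needed by the ring instance, depends on it. *)
Definition smooth_pred of open A : {pred A -> R[i]} :=
  fun f => `[< smooth_on A (extend0 f) >].

Lemma smooth_pred_restrict F : smooth_on A F ->
  (fun a : A => F (val a)) \in smooth_pred Aop.
Proof.
move=> sF; apply/asboolP; apply: smooth_on_eq sF => x Ax.
by rewrite extend0_restrict.
Qed.

Lemma smooth_pred_subring : subring_closed (smooth_pred Aop).
Proof.
split.
- exact: smooth_pred_restrict (smooth_on_cst 1).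
- move=> f g /asboolP sf /asboolP sg.
  have := smooth_pred_restrict (smooth_onD sf (smooth_onM (smooth_on_cst (-1)) sg)).
  suff -> : (fun a : A => extend0 f (val a) + -1 * extend0 g (val a)) = f - g by [].
  by apply/funext => a; rewrite !extend0E mulN1r.
- move=> f g /asboolP sf /asboolP sg.
  have := smooth_pred_restrict (smooth_onM sf sg).
  suff -> : (fun a : A => extend0 f (val a) * extend0 g (val a)) = f * g by [].
  by apply/funext => a; rewrite !extend0E.
Qed.

Record smooth_fun := SmoothFun {
  smooth_val :> A -> R[i];
  smooth_valP : smooth_val \in smooth_pred Aop }.

HB.instance Definition _ := [isSub for smooth_val].
HB.instance Definition _ := [Choice of smooth_fun by <:].
HB.instance Definition _ := GRing.SubChoice_isSubComPzRing.Build
  (A -> R[i]) (smooth_pred Aop) smooth_fun smooth_pred_subring.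

Lemma smooth_funP (f f' : smooth_fun) : (forall a, f a = f' a) -> f = f'.
Proof. by move=> ff; apply/val_inj/funext. Qed.

Lemma smooth_funD (f f' : smooth_fun) a : (f + f') a = f a + f' a.
Proof. by []. Qed.

Lemma smooth_funN (f : smooth_fun) a : (- f) a = - f a.
Proof. by []. Qed.

Lemma smooth_funM (f f' : smooth_fun) a : (f * f') a = f a * f' a.
Proof. by []. Qed.

Lemma smooth_fun1 a : (1 : smooth_fun) a = 1.
Proof. by []. Qed.

Lemma smooth_fun_nat n a : (n%:R : smooth_fun) a = n%:R.
Proof. by elim: n => // n IH; rewrite -!natr1 smooth_funD IH. Qed.

Lemma smooth_fun_sum (J : Type) (r : seq J) (P : pred J) (F : J -> smooth_fun) a :
  (\sum_(j <- r | P j) F j) a = \sum_(j <- r | P j) F j a.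
Proof. exact: (big_morph (fun f : smooth_fun => f a) (fun f f' => smooth_funD f f' a)). Qed.

Lemma smooth_fun_on (f : smooth_fun) : smooth_on A (extend0 f).
Proof. exact/asboolP/smooth_valP. Qed.

Definition smooth_restrict F (sF : smooth_on A F) : smooth_fun :=
  SmoothFun (smooth_pred_restrict sF).

Definition real_fun g (sg : forall p, Cdiff_on A p g) : smooth_fun :=
  smooth_restrict (smooth_on_real sg).

Lemma real_funE g (sg : forall p, Cdiff_on A p g) a :
  real_fun sg a = (g (val a))%:C.
Proof. by []. Qed.

Definition const_fun (c : R[i]) : smooth_fun := smooth_restrict (smooth_on_cst c).

Definition emb (c : R) : smooth_fun := const_fun c%:C.

Lemma emb_zmod_morphism : zmod_morphism emb.
Proof. by move=> c d; apply: smooth_funP => a; rewrite /= rmorphB. Qed.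

Lemma emb_monoid_morphism : monoid_morphism emb.
Proof. by split=> [|c d]; apply: smooth_funP => a; rewrite /= ?rmorph1 ?rmorphM. Qed.

HB.instance Definition _ := GRing.isZmodMorphism.Build R smooth_fun emb
  emb_zmod_morphism.
HB.instance Definition _ := GRing.isMonoidMorphism.Build R smooth_fun emb
  emb_monoid_morphism.

Definition diff_fun v (f : smooth_fun) : smooth_fun :=
  smooth_restrict (smooth_on_cderive v (smooth_fun_on f)).

Lemma cderive_eq v F G x : A x -> (forall y, A y -> F y = G y) ->
  cderive v F x = cderive v G x.
Proof.
move=> Ax FG; rewrite /cderive; congr (_ +i* _);
  by apply: (derive_eq_on Aop) => // y Ay; rewrite FG.
Qed.

Definition agree F (f : smooth_fun) := forall a : A, F (val a) = f a.

Lemma agree_on F f x : agree F f -> A x -> F x = extend0 f x.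
Proof.
by move=> Ff Ax; have := Ff (exist _ x (mem_set Ax)); rewrite -extend0E.
Qed.

Lemma agree_smooth_on F f : agree F f -> smooth_on A F.
Proof.
by move=> Ff; apply: smooth_on_eq (smooth_fun_on f) => x Ax; rewrite (agree_on Ff).
Qed.

Lemma agree_smooth_restrict F (sF : smooth_on A F) : agree F (smooth_restrict sF).
Proof. by []. Qed.

(** Quantifying over every total [F] that agrees with [f] makes the relation stable under
    composition, since nothing is known of [P F] off [A]. *)
Definition represents (P : operator V) (Q : smooth_fun -> smooth_fun) :=
  forall F f, agree F f -> agree (P F) (Q f).

Lemma represents_diff v : represents (cderive v) (diff_fun v).
Proof.
move=> F f Ff a; apply: cderive_eq; first exact/set_mem/(valP a).
by move=> y; exact: agree_on.
Qed.

Lemma represents_prod k (P : nat -> operator V) Q :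
  (forall j, represents (P j) (Q j)) ->
  represents (prod_op k P) (comp_range Q 1 k.+1).
Proof.
move=> PQ; apply: (big_ind2 represents) => // P1 Q1 P2 Q2 PQ1 PQ2 F f Ff.
exact/PQ1/PQ2.
Qed.

Lemma smooth_differentiable F x : smooth_on A F -> A x ->
  differentiable (fun y => complex.Re (F y)) x /\
  differentiable (fun y => complex.Im (F y)) x.
Proof. by move=> sF Ax; have [[r _] [i _]] := sF 1%N; split; [exact: r|exact: i]. Qed.

Lemma cderiveD v F G x : smooth_on A F -> smooth_on A G -> A x ->
  cderive v (fun y => F y + G y) x = cderive v F x + cderive v G x.
Proof.
move=> sF sG Ax; have [rF iF] := smooth_differentiable sF Ax.
have [rG iG] := smooth_differentiable sG Ax.
rewrite /cderive -[RHS]/(_ +i* _); congr (_ +i* _).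
- rewrite -deriveD; try exact: diff_derivable.
  by congr ('D_v _ x); apply/funext => y; rewrite !fctE; case: (F y) (G y) => ? ? [].
- rewrite -deriveD; try exact: diff_derivable.
  by congr ('D_v _ x); apply/funext => y; rewrite !fctE; case: (F y) (G y) => ? ? [].
Qed.

Lemma cderiveM v F G x : smooth_on A F -> smooth_on A G -> A x ->
  cderive v (fun y => F y * G y) x = cderive v F x * G x + F x * cderive v G x.
Proof.
move=> sF sG Ax; have [rF iF] := smooth_differentiable sF Ax.
have [rG iG] := smooth_differentiable sG Ax.
have D g h : differentiable g x -> differentiable h x ->
    'D_v (fun y => g y * h y) x = g x * 'D_v h x + h x * 'D_v g x.
  by move=> dg dh; rewrite -deriveM //; exact: diff_derivable.
have dM g h : differentiable g x -> differentiable h x ->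
    derivable (fun y => g y * h y) x v.
  by move=> dg dh; apply: derivableM; exact: diff_derivable.
have -> : cderive v (fun y => F y * G y) x =
   ('D_v (fun y => complex.Re (F y) * complex.Re (G y)) x
    - 'D_v (fun y => complex.Im (F y) * complex.Im (G y)) x) +i*
   ('D_v (fun y => complex.Re (F y) * complex.Im (G y)) x
    + 'D_v (fun y => complex.Im (F y) * complex.Re (G y)) x).
  rewrite /cderive -deriveB -?deriveD; try exact: dM.
  by congr ('D_v _ x +i* 'D_v _ x); apply/funext => y; rewrite !fctE; case: (F y) (G y) => ? ? [].
rewrite !D // /cderive; case: (F x) (G x) => a b [c d] /=.
by apply/eqP; rewrite eq_complex /=; apply/andP; split; apply/eqP; ring.
Qed.

Lemma derivation_diff_fun v : derivation (diff_fun v).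
Proof.
split=> f f'; apply: smooth_funP => a; have Aa : A (val a) by exact/set_mem/(valP a).
- rewrite smooth_funD /= -cderiveD //; try exact: smooth_fun_on.
  apply: cderive_eq => // y Ay; have yA : y \in A by exact: mem_set.
  by rewrite -[y]/(val (exist _ y yA : A)) !extend0E.
- rewrite smooth_funD !smooth_funM /= -!extend0E -cderiveM //; try exact: smooth_fun_on.
  apply: cderive_eq => // y Ay; have yA : y \in A by exact: mem_set.
  by rewrite -[y]/(val (exist _ y yA : A)) !extend0E.
Qed.

Lemma cderive_comm v w F x : smooth_on A F -> A x ->
  cderive v (cderive w F) x = cderive w (cderive v F) x.
Proof.
move=> sF Ax; have [r i] := sF 2%N.
have p := derive_comm Aop w v Ax r.
have q := derive_comm Aop w v Ax i.
by rewrite /cderive p q.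
Qed.

Lemma diff_funC v w f : diff_fun v (diff_fun w f) = diff_fun w (diff_fun v f).
Proof.
apply: smooth_funP => a; have Aa : A (val a) by exact/set_mem/(valP a).
have E u u' : diff_fun u (diff_fun u' f) a = cderive u (cderive u' (extend0 f)) (val a).
  apply: cderive_eq => // y Ay; have yA : y \in A by exact: mem_set.
  by rewrite -[y]/(val (exist _ y yA : A)) extend0E.
exact: etrans (E v w) (etrans (cderive_comm v w (smooth_fun_on f) Aa) (esym (E w v))).
Qed.

Lemma diff_const_fun v c : diff_fun v (const_fun c) = 0.
Proof.
apply: smooth_funP => a; rewrite -(represents_diff v (agree_smooth_restrict _)).
by rewrite /cderive !derive_cst.
Qed.

Lemma diff_real_fun v g (sg : forall p, Cdiff_on A p g) a :
  diff_fun v (real_fun sg) a = ('D_v g (val a))%:C.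
Proof.
rewrite -(represents_diff v (agree_smooth_restrict _)).
by rewrite /cderive /= derive_cst.
Qed.

Section Powers.
Variables (g : V -> R) (sg : forall p, Cdiff_on A p g).
Hypothesis g0 : forall x, A x -> 0 < g x.

Definition pow_fun s : smooth_fun :=
  real_fun (fun p => Cdiff_on_powR Aop s g0 (sg p)).

Lemma pow_funD s t : pow_fun (s + t) = pow_fun s * pow_fun t.
Proof.
apply: smooth_funP => a; rewrite smooth_funM /= -rmorphM -powRD //.
by apply/implyP => _; apply: lt0r_neq0; exact: g0 (set_mem (valP a)).
Qed.

Lemma pow_fun0 : pow_fun 0 = 1.
Proof. by apply: smooth_funP => a; rewrite /= powRr0. Qed.

Lemma pow_fun1 : pow_fun 1 = real_fun sg.
Proof.
apply: smooth_funP => a; rewrite /= powRr1 //.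
exact/ltW/(g0 (set_mem (valP a))).
Qed.

Lemma diff_pow_fun v s :
  diff_fun v (pow_fun s) = emb s * pow_fun (s - 1) * diff_fun v (real_fun sg).
Proof.
apply: smooth_funP => a; have Aa : A (val a) by exact/set_mem/(valP a).
rewrite !smooth_funM !diff_real_fun /= derive_powR //; last 2 first.
- exact: g0.
- by have [dg _] := sg 1; exact: dg.
by rewrite !rmorphM.
Qed.

End Powers.

End SmoothFunctions.

(** * The two models *)

Section Coordinates.
Context {R : realType} {n : nat}.
Local Notation Cn := (Cspace R n).
Implicit Types (A : set Cn).

Definition xcoord (j : 'I_n) (z : Cn) : R := z.1 0 j.
Definition ycoord (j : 'I_n) (z : Cn) : R := z.2 0 j.

Lemma xcoord_is_linear j : linear (xcoord j).
Proof. by move=> a z w; rewrite /xcoord /= !mxE. Qed.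

Lemma ycoord_is_linear j : linear (ycoord j).
Proof. by move=> a z w; rewrite /ycoord /= !mxE. Qed.

HB.instance Definition _ j := GRing.isLinear.Build R Cn R _ (xcoord j)
  (xcoord_is_linear j).
HB.instance Definition _ j := GRing.isLinear.Build R Cn R _ (ycoord j)
  (ycoord_is_linear j).

Lemma xcoord_continuous j : continuous (xcoord j).
Proof.
move=> z; apply: (@continuous_comp _ _ _ fst (fun u : 'rV[R]_n => u 0 j)).
  exact: cvg_fst.
exact: coord_continuous.
Qed.

Lemma ycoord_continuous j : continuous (ycoord j).
Proof.
move=> z; apply: (@continuous_comp _ _ _ snd (fun u : 'rV[R]_n => u 0 j)).
  exact: cvg_snd.
exact: coord_continuous.
Qed.

End Coordinates.

Section LinearFunctions.
Context {R : realType} {V : normedModType R}.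
Variables (A : set V) (Aop : open A).

Lemma derive_linear (l : {linear V -> R}) v x :
  continuous l -> 'D_v l x = l v.
Proof.
by move=> lc; rewrite deriveE ?diff_lin //; exact: linear_differentiable.
Qed.

Lemma Cdiff_on_linear (l : {linear V -> R}) p : continuous l -> Cdiff_on A p l.
Proof.
move=> lc; case: p => [|p]; first by move=> x _; exact: lc.
split=> [x _|v]; first exact: linear_differentiable.
apply: Cdiff_on_eq (Cdiff_on_cst Aop p (l v)) => // x _.
by rewrite derive_linear.
Qed.

Lemma Cdiff_on_sum p (J : Type) (r : seq J) (F : J -> V -> R) :
  (forall j, Cdiff_on A p (F j)) -> Cdiff_on A p (fun x => \sum_(j <- r) F j x).
Proof.
move=> FC; elim: r => [|j r IH].
  by apply: Cdiff_on_eq (Cdiff_on_cst Aop p 0) => // x _; rewrite big_nil.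
by apply: Cdiff_on_eq (Cdiff_onD Aop (FC j) IH) => // x _; rewrite big_cons.
Qed.

End LinearFunctions.

Section CoordinateFunctions.
Context {R : realType} {n : nat}.
Local Notation Cn := (Cspace R n).
Variables (A : set Cn) (Aop : open A).

Lemma Cdiff_on_xcoord j p : Cdiff_on A p (xcoord j).
Proof. exact/(Cdiff_on_linear Aop)/xcoord_continuous. Qed.

Lemma Cdiff_on_ycoord j p : Cdiff_on A p (ycoord j).
Proof. exact/(Cdiff_on_linear Aop)/ycoord_continuous. Qed.

Definition xfun j : smooth_fun Aop := real_fun Aop (Cdiff_on_xcoord j).
Definition yfun j : smooth_fun Aop := real_fun Aop (Cdiff_on_ycoord j).

Lemma diff_xfun v j : diff_fun v (xfun j) = emb Aop (xcoord j v).
Proof.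
apply: smooth_funP => a; rewrite diff_real_fun /= derive_linear //.
exact: xcoord_continuous.
Qed.

Lemma diff_yfun v j : diff_fun v (yfun j) = emb Aop (ycoord j v).
Proof.
apply: smooth_funP => a; rewrite diff_real_fun /= derive_linear //.
exact: ycoord_continuous.
Qed.

Lemma xcoord_basis_x (j k : 'I_n) : xcoord j (basis_x k : Cn) = (j == k)%:R.
Proof. by rewrite /xcoord mxE eqxx. Qed.

Lemma xcoord_basis_y (j k : 'I_n) : xcoord j (basis_y k : Cn) = 0.
Proof. by rewrite /xcoord mxE. Qed.

Lemma ycoord_basis_x (j k : 'I_n) : ycoord j (basis_x k : Cn) = 0.
Proof. by rewrite /ycoord mxE. Qed.

Lemma ycoord_basis_y (j k : 'I_n) : ycoord j (basis_y k : Cn) = (j == k)%:R.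
Proof. by rewrite /ycoord mxE eqxx. Qed.

Lemma Cdiff_on_normsq p : Cdiff_on A p normsq.
Proof.
apply: (Cdiff_on_sum Aop) => j.
have sqr (g : Cn -> R) : (forall p, Cdiff_on A p g) -> Cdiff_on A p (fun z => g z ^+ 2).
  by move=> gC; apply: Cdiff_on_eq (Cdiff_onM Aop (gC p) (gC p)).
exact: (Cdiff_onD Aop (sqr _ (Cdiff_on_xcoord j)) (sqr _ (Cdiff_on_ycoord j))).
Qed.

End CoordinateFunctions.

Section DerivationCombinations.
Variables (K : comPzRingType) (D1 D2 : K -> K).
Hypotheses (dD1 : derivation D1) (dD2 : derivation D2).

Lemma derivation_add : derivation (fun f => D1 f + D2 f).
Proof.
split=> f g; first by rewrite !(derivationD dD1, derivationD dD2); ring.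
by rewrite !(derivationM dD1, derivationM dD2); ring.
Qed.

Lemma derivation_scale (c : K) : derivation (fun f => c * D1 f).
Proof.
split=> f g; first by rewrite (derivationD dD1); ring.
by rewrite (derivationM dD1); ring.
Qed.

End DerivationCombinations.

Section ComplexCoordinates.
Context {R : realType} {n : nat}.
Local Notation Cn := (Cspace R n).
Variables (A : set Cn) (Aop : open A).
Local Notation K := (smooth_fun Aop).
Local Notation emb := (emb Aop).

Definition imag_fun : K := const_fun Aop 'i%C.
Local Notation I := imag_fun.

Lemma imag_fun2 : I * I = -1.
Proof. by apply: smooth_funP => a; rewrite smooth_funM /= -expr2 sqr_i. Qed.

Definition dx_fun j : K -> K := diff_fun (basis_x j).
Definition dy_fun j : K -> K := diff_fun (basis_y j).

Lemma derivation_dx j : derivation (dx_fun j).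
Proof. exact: derivation_diff_fun. Qed.

Lemma derivation_dy j : derivation (dy_fun j).
Proof. exact: derivation_diff_fun. Qed.

Lemma dx_xfun j k : dx_fun j (xfun Aop k) = (k == j)%:R.
Proof. by rewrite /dx_fun diff_xfun xcoord_basis_x rmorph_nat. Qed.

Lemma dx_yfun j k : dx_fun j (yfun Aop k) = 0.
Proof. by rewrite /dx_fun diff_yfun ycoord_basis_x rmorph0. Qed.

Lemma dy_xfun j k : dy_fun j (xfun Aop k) = 0.
Proof. by rewrite /dy_fun diff_xfun xcoord_basis_y rmorph0. Qed.

Lemma dy_yfun j k : dy_fun j (yfun Aop k) = (k == j)%:R.
Proof. by rewrite /dy_fun diff_yfun ycoord_basis_y rmorph_nat. Qed.

Definition zfun j : K := xfun Aop j + I * yfun Aop j.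
Definition zbfun j : K := xfun Aop j - I * yfun Aop j.
(** The sign is attached to the coefficient so that the term is literally a sum of scaled
    derivations, as [derivation_add] and [derivation_scale] expect. *)
Definition dz_fun j (f : K) : K := emb 2^-1 * (dx_fun j f + - I * dy_fun j f).
Definition dzb_fun j (f : K) : K := emb 2^-1 * (dx_fun j f + I * dy_fun j f).

Lemma derivation_dz j : derivation (dz_fun j).
Proof.
apply: derivation_scale; apply: derivation_add; first exact: derivation_dx.
exact/derivation_scale/derivation_dy.
Qed.

Lemma derivation_dzb j : derivation (dzb_fun j).
Proof.
apply: derivation_scale; apply: derivation_add; first exact: derivation_dx.
exact/derivation_scale/derivation_dy.
Qed.

Lemma emb_half : emb 2^-1 * 2 = 1.
Proof. by rewrite -(rmorph_nat emb 2) -rmorphM mulVf ?rmorph1 // pnatr_eq0. Qed.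

Let dxE j := (derivationD (derivation_dx j), derivationM (derivation_dx j),
  derivationN (derivation_dx j), derivation0 (derivation_dx j),
  fun c => diff_const_fun Aop (basis_x j) c : dx_fun j (const_fun Aop c) = 0).
Let dyE j := (derivationD (derivation_dy j), derivationM (derivation_dy j),
  derivationN (derivation_dy j), derivation0 (derivation_dy j),
  fun c => diff_const_fun Aop (basis_y j) c : dy_fun j (const_fun Aop c) = 0).

Lemma dzb_dzb j k f : dzb_fun j (dzb_fun k f) = dzb_fun k (dzb_fun j f).
Proof.
rewrite /dzb_fun !(dxE, dyE) /dx_fun /dy_fun !(mul0r, add0r, oppr0).
rewrite (diff_funC (basis_x k) (basis_x j)) (diff_funC (basis_x k) (basis_y j)).
by rewrite (diff_funC (basis_y k) (basis_x j)) (diff_funC (basis_y k) (basis_y j)); ring.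
Qed.

Lemma dzb_dz j k f : dzb_fun j (dz_fun k f) = dz_fun k (dzb_fun j f).
Proof.
rewrite /dzb_fun /dz_fun !(dxE, dyE) /dx_fun /dy_fun !(mul0r, add0r, oppr0).
rewrite (diff_funC (basis_x k) (basis_x j)) (diff_funC (basis_x k) (basis_y j)).
by rewrite (diff_funC (basis_y k) (basis_x j)) (diff_funC (basis_y k) (basis_y j)); ring.
Qed.

Lemma dz_emb j c : dz_fun j (emb c) = 0.
Proof. by rewrite /dz_fun !(dxE, dyE) !(mulr0, addr0). Qed.

Lemma dzb_emb j c : dzb_fun j (emb c) = 0.
Proof. by rewrite /dzb_fun !(dxE, dyE) !(mulr0, addr0). Qed.

Let coordE := (dx_xfun, dx_yfun, dy_xfun, dy_yfun).

Lemma dz_z j k : dz_fun j (zfun k) = (j == k)%:R.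
Proof.
rewrite /dz_fun /zfun !(dxE, dyE, coordE) eq_sym.
(* One half is a mere element of [K]; writing 1 as [emb 2^-1 * 2] on the right makes this a
   polynomial identity modulo I^2 = -1. *)
by rewrite -[RHS]mul1r -emb_half; ring: imag_fun2.
Qed.

Lemma dz_zb j k : dz_fun j (zbfun k) = 0.
Proof. by rewrite /dz_fun /zbfun !(dxE, dyE, coordE); ring: imag_fun2. Qed.

Lemma dzb_z j k : dzb_fun j (zfun k) = 0.
Proof. by rewrite /dzb_fun /zfun !(dxE, dyE, coordE); ring: imag_fun2. Qed.

Lemma dzb_zb j k : dzb_fun j (zbfun k) = (j == k)%:R.
Proof.
rewrite /dzb_fun /zbfun !(dxE, dyE, coordE) eq_sym.
by rewrite -[RHS]mul1r -emb_half; ring: imag_fun2.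
Qed.

Lemma zfunE j a : zfun j a = Defs.coord j (val a).
Proof.
by rewrite smooth_funD smooth_funM /= /Defs.coord /xcoord /ycoord; simpc.
Qed.

Lemma zbfunE j a : zbfun j a = conjc (Defs.coord j (val a)).
Proof.
by rewrite smooth_funD smooth_funN smooth_funM /= /Defs.coord /xcoord /ycoord; simpc.
Qed.

Lemma emb_val c a : emb c a = c%:C.
Proof. by []. Qed.

Lemma imag_fun_val a : I a = 'i%C.
Proof. by []. Qed.

Lemma represents_dz j : represents (dz j) (dz_fun j).
Proof.
move=> F f Ff a; rewrite /dz (represents_diff _ Ff) (represents_diff (basis_y j) Ff).
rewrite smooth_funM smooth_funD smooth_funM smooth_funN emb_val imag_fun_val.
by rewrite fmorphV rmorph_nat mulNr mulrC.
Qed.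

Lemma represents_dzb j : represents (dzbar j) (dzb_fun j).
Proof.
move=> F f Ff a; rewrite /dzbar (represents_diff _ Ff) (represents_diff (basis_y j) Ff).
rewrite smooth_funM smooth_funD smooth_funM emb_val imag_fun_val.
by rewrite fmorphV rmorph_nat mulrC.
Qed.

End ComplexCoordinates.

(** * The ball model *)

Section BallModel.
Context {R : realType} {n : nat}.
Local Notation Cn := (Cspace R n).

Lemma ball_dom_open : open (@ball_dom R n).
Proof.
apply: (@open_comp _ _ (@normsq R n) [set r | r < 1]); last exact: open_lt.
by move=> z _; exact: (Cdiff_on_normsq openT 0%N).
Qed.

Local Notation K := (smooth_fun ball_dom_open).
Local Notation emb := (emb ball_dom_open).
Local Notation zf := (zfun ball_dom_open).
Local Notation zbf := (zbfun ball_dom_open).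
Local Notation dzf := (@dz_fun _ _ _ ball_dom_open).
Local Notation dzbf := (@dzb_fun _ _ _ ball_dom_open).

Definition defect (z : Cn) : R := 1 - normsq z.

Lemma Cdiff_on_defect p : Cdiff_on ball_dom p defect.
Proof.
apply: Cdiff_on_eq (Cdiff_onD ball_dom_open (Cdiff_on_cst ball_dom_open p 1)
  (Cdiff_onM ball_dom_open (Cdiff_on_cst ball_dom_open p (-1))
    (Cdiff_on_normsq ball_dom_open p))) => [|z _]; first exact: ball_dom_open.
by rewrite /defect mulN1r.
Qed.

Lemma defect_gt0 z : ball_dom z -> 0 < defect z.
Proof. by rewrite /defect subr_gt0. Qed.

Local Notation pw := (pow_fun ball_dom_open Cdiff_on_defect defect_gt0).

Let pw1 : pw 1 = 1 - \sum_j zf j * zbf j.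
Proof.
rewrite pow_fun1; apply: smooth_funP => a.
rewrite smooth_funD smooth_funN smooth_fun_sum smooth_fun1 real_funE.
rewrite /defect /normsq rmorphB rmorph1 rmorph_sum; congr (_ - _).
apply: eq_bigr => j _; rewrite smooth_funM zfunE zbfunE /Defs.coord; simpc.
by congr (_ +i* _); ring.
Qed.

Let dz_pw1 j : dzf j (pw 1) = - zbf j.
Proof.
rewrite pw1 (derivationD (derivation_dz _ j)) (derivationN (derivation_dz _ j)).
rewrite (derivation1 (derivation_dz _ j)) add0r (derivation_sum (derivation_dz _ j)).
congr (- _); rewrite -[RHS](sum_delta _ j); apply: eq_bigr => k _.
by rewrite (derivationM (derivation_dz _ j)) dz_z dz_zb eq_sym mulr0 addr0.
Qed.

Let dzb_pw1 j : dzbf j (pw 1) = - zf j.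
Proof.
rewrite pw1 (derivationD (derivation_dzb _ j)) (derivationN (derivation_dzb _ j)).
rewrite (derivation1 (derivation_dzb _ j)) add0r (derivation_sum (derivation_dzb _ j)).
congr (- _); rewrite -[RHS](sum_delta _ j); apply: eq_bigr => k _.
by rewrite (derivationM (derivation_dzb _ j)) dzb_z dzb_zb eq_sym mul0r add0r mulrC.
Qed.

Let dz_pw j s : dzf j (pw s) = - (emb s * pw (s - 1) * zbf j).
Proof.
rewrite -mulrN -dz_pw1 /dz_fun /dx_fun /dy_fun !(diff_pow_fun _ _ _ _ s) pow_fun1.
by ring.
Qed.

Let dzb_pw j s : dzbf j (pw s) = - (emb s * pw (s - 1) * zf j).
Proof.
rewrite -mulrN -dzb_pw1 /dzb_fun /dx_fun /dy_fun !(diff_pow_fun _ _ _ _ s) pow_fun1.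
by ring.
Qed.

Local Notation M := (ballM emb zf zbf dzf dzbf).

Let represents_second_order : represents ball_second_order
  (fun f => flat_laplacian dzf dzbf f - euler zf dzf (eulerb zbf dzbf f)).
Proof.
move=> F f Ff a; rewrite (euler_eulerb zf dzbf (derivation_dz ball_dom_open) (@dz_zb _ _ _ _)).
rewrite smooth_funD smooth_funN !smooth_fun_sum -sumrB; apply: eq_bigr => j _.
have -> : dzf j (dzbf j f) = \sum_k (j == k)%:R * dzf j (dzbf k f).
  rewrite -[LHS](sum_delta (fun k => dzf j (dzbf k f))).
  by apply: eq_bigr => k _; rewrite eq_sym.
rewrite !smooth_fun_sum -sumrB; apply: eq_bigr => k _.
have := represents_dz j (represents_dzb k Ff) a; move: (dzf j (dzbf k f)) => D ->.
by rewrite !smooth_funM zfunE zbfunE smooth_fun_nat; ring.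
Qed.

Let represents_radial : represents radial (euler zf dzf).
Proof.
move=> F f Ff a; rewrite smooth_fun_sum; apply: eq_bigr => j _.
by rewrite smooth_funM zfunE (represents_dz j Ff).
Qed.

Let represents_radial_bar : represents radial_bar (eulerb zbf dzbf).
Proof.
move=> F f Ff a; rewrite smooth_fun_sum; apply: eq_bigr => j _.
by rewrite smooth_funM zbfunE (represents_dzb j Ff).
Qed.

Theorem ball_factorization (a : R) k (f : Cn -> R[i]) :
  smooth_on ball_dom f -> forall z : Cn, ball_dom z ->
  prod_op k (fun j v w =>
      Delta' ((1 - a%:C - n%:R) / 2) ((1 - a%:C - n%:R) / 2) v w
      + (k%:R + 1 - 2 * j%:R) ^+ 2 / 4 * v w
      - (k%:R + 1 - 2 * j%:R) / 2 * (radial v w - radial_bar v w))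
    (fun w => ((1 - normsq w) `^ ((k%:R - n%:R - a) / 2))%:C * f w) z
  = 4 ^- k * ((1 - normsq z) `^ (- ((k%:R + n%:R + a) / 2)))%:C
    * prod_op k (fun j v w =>
        ball_laplacian v w
        + (n%:R ^+ 2 - (a%:C - k%:R + 2 * j%:R - 2) ^+ 2) * v w) f z.
Proof.
move=> sf z Az; pose b : ball_dom := exist _ z (mem_set Az).
set P := fun j : nat => _; set Q := fun j : nat => _ : operator _.
(* With c = k + 1 - 2j, the factor has alpha = (1-a-n)/2 - c/2 and beta = (1-a-n)/2 + c/2. The terms
   in R and Rbar are these shifts, and c^2 / 4 completes -((1-a-n)/2)^2 to -alpha beta. *)
have PM : represents (prod_op k P) (comp_range (fun j =>
    M ((a - (k%:R + 1 - 2 * j%:R)) / 2) ((a + (k%:R + 1 - 2 * j%:R)) / 2)) 1 k.+1).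
  apply: represents_prod => j F h Fh b'; rewrite /P /Delta'.
  rewrite (represents_second_order Fh) (represents_radial Fh) (represents_radial_bar Fh).
  rewrite (Fh b') /ballM !(smooth_funD, smooth_funN, smooth_funM, emb_val).
  by rewrite !(rmorphB, rmorphD, rmorphM, fmorphV, rmorph_nat, rmorph1); field.
have QM : represents (prod_op k Q) (comp_range (fun j =>
    shifted_laplacian emb pw M ((1 - n%:R) / 2) (n%:R ^+ 2 - (a - k%:R + 2 * j%:R - 2) ^+ 2)) 1 k.+1).
  apply: represents_prod => j F h Fh b'; rewrite /Q /ball_laplacian.
  rewrite (represents_second_order Fh) (Fh b') /shifted_laplacian /ballM pow_fun1.
  rewrite !(smooth_fun_nat, smooth_funD, smooth_funN, smooth_funM, emb_val, real_funE).
  (* At p = q = (1-n)/2 both alpha and beta vanish, which leaves the bare second-order operator. *)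
  rewrite /defect !subrr mul0r.
  by rewrite !(rmorphB, rmorphD, rmorphXn, rmorphM, fmorphV, rmorph_nat, rmorph1, rmorph0); ring.
have Pf : agree (fun w => ((1 - normsq w) `^ ((k%:R - n%:R - a) / 2))%:C * f w)
    (pw ((k%:R - n%:R - a) / 2) * smooth_restrict ball_dom_open sf) by [].
rewrite -[z]/(val b) (PM _ _ Pf) (QM _ _ (agree_smooth_restrict _ sf)).
rewrite (@factorization R K emb pw M _ _ _ _ _ ((1 - n%:R) / 2) n%:R a k) //.
- by rewrite !smooth_funM emb_val real_funE fmorphV rmorphXn rmorph_nat mulrA.
- exact: pow_funD.
- exact: (ballMD _ _ _ (derivation_dz _) (derivation_dzb _)).
- exact: (ballMZ _ _ (derivation_dz _) (derivation_dzb _) (@dz_emb _ _ _ _) (@dzb_emb _ _ _ _)).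
- exact: (ballM_exchange (derivation_dz _) (derivation_dzb _) (@dzb_dzb _ _ _ _)
    (@dzb_dz _ _ _ _) (@dz_emb _ _ _ _) (@dzb_emb _ _ _ _) (@dz_zb _ _ _ _)
    (@dzb_z _ _ _ _) (@dzb_zb _ _ _ _)).
- exact: (ballM_pw (pow_funD _ _ _) (pow_fun0 _ _ _) pw1 (derivation_dz _)
    (derivation_dzb _) (@dz_emb _ _ _ _) (@dz_z _ _ _ _) dz_pw dzb_pw).
Qed.

End BallModel.

(** * Siegel coordinate derivatives as Cartesian directional derivatives *)

Section DirectionalDerivatives.
Context {R : realType} {V W : normedModType R}.

(** Along the line c + tv the map phi is a quadratic curve with velocity e at t = 0, where the term
    in e' has derivative zero. This form suits the Siegel coordinates, whose only nonlinearity is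
    |z'|^2. *)
Lemma derive_curve (g : W -> R) (phi : V -> W) (c v : V) (e e' : W) :
  (forall t : R, phi (c + t *: v) = phi c + t *: e + t ^+ 2 *: e') ->
  differentiable g (phi c) -> 'D_v (g \o phi) c = 'D_e g (phi c).
Proof.
move=> phiE dg; pose gam (t : R) : W := phi c + t *: e + t ^+ 2 *: e'.
have gam0 : gam 0 = phi c by rewrite /gam expr0n !scale0r !addr0.
have dgam : is_diff (0 : R) gam ( *:%R^~ e).
  have dsq : is_diff (0 : R) (( *:%R^~ e') \o (fun t : R => t ^+ 2)) 0.
    apply: is_diff_eq (is_diff_comp (is_diffX 1 (is_diff_id _)) (is_diff_scalel _ _)) _.
    by rewrite expr1 mulr0 scale0r; apply/funext => t /=; rewrite scale0r.
  apply: is_diff_eq (is_diffD (is_diffD (is_diff_cst (phi c) _) (is_diff_scalel _ e)) dsq) _.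
  by rewrite addr0 add0r.
have -> : 'D_v (g \o phi) c = 'D_1 (g \o gam) 0.
  rewrite /derive; set F1 := fun h : R => h^-1 *: _; set F2 := fun h : R => h^-1 *: _.
  suff -> : F1 = F2 by [].
  apply/funext => h; rewrite /F1 /F2 /= gam0 addr0 [h *: 1]mulr1 [h *: v + c]addrC phiE.
  by [].
rewrite !deriveE //; last first.
  by apply: differentiable_comp; [exact: ex_diff|rewrite gam0].
rewrite (@diff_comp _ _ _ _ gam g) ?gam0 //.
by rewrite diff_val /= scale1r.
Qed.

Lemma derive_direction (g : V -> R) (v w : V) (c : R) x : differentiable g x ->
  'D_(v + c *: w) g x = 'D_v g x + c * 'D_w g x.
Proof. by move=> dg; rewrite !deriveE // linearD linearZ. Qed.

Lemma cderive_direction (A : set V) (F : V -> R[i]) (v w : V) (c : R) x :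
  open A -> smooth_on A F -> A x ->
  cderive (v + c *: w) F x = cderive v F x + c%:C * cderive w F x.
Proof.
move=> Aop sF Ax; have [dr di] := smooth_differentiable sF Ax.
by rewrite /cderive (derive_direction _ _ _ dr) (derive_direction _ _ _ di); simpc.
Qed.

End DirectionalDerivatives.

Section CoordinateChange.
Context {R : realType} {m : nat}.
Local Notation Cn := (Cspace R m.+1).

Lemma coord_derive_curve (v : @Scoords R m) (e e' : Cn) (u : Cn -> R[i]) (z : Cn) :
  open (@siegel R m) -> smooth_on siegel u -> siegel z ->
  (forall t : R, of_coords (to_coords z + t *: v) = z + t *: e + t ^+ 2 *: e') ->
  coord_derive v u z = cderive e u z.
Proof.
move=> So su Sz vE; have [dr di] := smooth_differentiable su Sz.
have E (g : Cn -> R) : differentiable g z ->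
    'D_v (g \o @of_coords R m) (to_coords z) = 'D_e g z.
  move=> dg; rewrite -{2}[z]to_coordsK; apply: derive_curve => [t|].
    by rewrite vE to_coordsK.
  by rewrite to_coordsK.
by rewrite /coord_derive /cderive -(E _ dr) -(E _ di).
Qed.

Lemma sum_update (F : 'I_m -> R) (G : 'I_m -> R) j (b : R) :
  (forall k, F k = G k + (k == j)%:R * b) -> \sum_k F k = \sum_k G k + b.
Proof.
move=> FG; rewrite (eq_bigr _ (fun k _ => FG k)) big_split /=.
by rewrite (sum_delta (fun=> b)).
Qed.

Lemma normsq_add_x (w : Cspace R m) j (t : R) :
  normsq (w + t *: basis_x j) = normsq w + (2 * w.1 0 j * t + t ^+ 2).
Proof.
apply: (sum_update (j := j)) => k; rewrite !mxE eqxx /=.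
by case: eqVneq => [->|_] /=; ring.
Qed.

Lemma normsq_add_y (w : Cspace R m) j (t : R) :
  normsq (w + t *: basis_y j) = normsq w + (2 * w.2 0 j * t + t ^+ 2).
Proof.
apply: (sum_update (j := j)) => k; rewrite !mxE eqxx /=.
by case: eqVneq => [->|_] /=; ring.
Qed.

Let lift_max (i : 'I_m) : (lift ord_max i == ord_max :> 'I_m.+1) = false.
Proof. by rewrite eq_sym; exact/negbTE/neq_lift. Qed.

Let max_lift (i : 'I_m) : (ord_max == lift ord_max i :> 'I_m.+1) = false.
Proof. exact/negbTE/neq_lift. Qed.

Lemma of_coords_dt (z : Cn) (t : R) :
  of_coords (to_coords z + t *: ((0, 1, 0) : @Scoords R m)) =
  z + t *: basis_x ord_max + t ^+ 2 *: (0 : Cn).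
Proof.
rewrite /of_coords /to_coords /= !scaler0 !addr0; case: z => x y.
congr pair; apply/rowP => k; rewrite !mxE ?eqxx; case: unliftP => [i ->|->] /=.
- by rewrite !mxE lift_max mulr0n; ring.
- by rewrite /tcoord /= [t *: 1]mulr1 eqxx mulr1n; ring.
- by rewrite !mxE; ring.
- by rewrite /varrho /=; ring.
Qed.

Lemma of_coords_drho (z : Cn) (t : R) :
  of_coords (to_coords z + t *: ((0, 0, 1) : @Scoords R m)) =
  z + t *: basis_y ord_max + t ^+ 2 *: (0 : Cn).
Proof.
rewrite /of_coords /to_coords /= !scaler0 !addr0; case: z => x y.
congr pair; apply/rowP => k; rewrite !mxE ?eqxx; case: unliftP => [i ->|->] /=.
- by rewrite !mxE; ring.
- by rewrite /tcoord /=; ring.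
- by rewrite !mxE lift_max mulr0n; ring.
- by rewrite eqxx mulr1n /varrho /= [t *: 1]mulr1; ring.
Qed.

(** With x_n and rho fixed, y_n = rho + |z'|^2 follows a change t of x_j by 2 x_j t + t^2. The
    coordinate field is therefore d/dx_j + 2 x_j d/dy_n in Cartesian terms. *)
Lemma of_coords_dx j (z : Cn) (t : R) :
  of_coords (to_coords z + t *: ((basis_x j, 0, 0) : @Scoords R m)) =
  z + t *: (basis_x (lift ord_max j) + (2 * z.1 0 (lift ord_max j)) *: basis_y ord_max)
    + t ^+ 2 *: basis_y ord_max.
Proof.
rewrite /of_coords /to_coords /= !scaler0 !addr0 normsq_add_x.
case: z => x y; congr pair; apply/rowP => k; rewrite !mxE ?eqxx.
  case: unliftP => [i ->|->] /=.
    by rewrite !mxE (inj_eq lift_inj) /= ?eqxx /=; ring.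
  by rewrite max_lift mulr0n /tcoord /=; ring.
case: unliftP => [i ->|->] /=; first by rewrite !mxE lift_max mulr0n; ring.
by rewrite eqxx mulr1n /varrho /= ?mxE; ring.
Qed.

Lemma of_coords_dy j (z : Cn) (t : R) :
  of_coords (to_coords z + t *: ((basis_y j, 0, 0) : @Scoords R m)) =
  z + t *: (basis_y (lift ord_max j) + (2 * z.2 0 (lift ord_max j)) *: basis_y ord_max)
    + t ^+ 2 *: basis_y ord_max.
Proof.
rewrite /of_coords /to_coords /= !scaler0 !addr0 normsq_add_y.
case: z => x y; congr pair; apply/rowP => k; rewrite !mxE ?eqxx.
  case: unliftP => [i ->|->] /=; first by rewrite !mxE; ring.
  by rewrite /tcoord /=; ring.
case: unliftP => [i ->|->] /=.
  by rewrite !mxE (inj_eq lift_inj) lift_max mulr0n ?eqxx /=; ring.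
by rewrite eqxx max_lift mulr0n mulr1n /varrho /= ?mxE; ring.
Qed.

End CoordinateChange.

(** * The Siegel domain model *)

Section SiegelModel.
Context {R : realType} {m : nat}.
Local Notation Cn := (Cspace R m.+1).
Local Notation lft := (@lift m.+1 ord_max).

Lemma Cdiff_on_varrho (A : set Cn) p : open A -> Cdiff_on A p (@varrho R m).
Proof.
move=> Aop; have sqr (g : Cn -> R) : Cdiff_on A p g -> Cdiff_on A p (fun z => g z ^+ 2).
  by move=> gC; apply: Cdiff_on_eq (Cdiff_onM Aop gC gC).
have S := Cdiff_on_sum Aop (index_enum 'I_m) (fun j : 'I_m => Cdiff_onD Aop
  (sqr _ (Cdiff_on_xcoord Aop (lft j) p)) (sqr _ (Cdiff_on_ycoord Aop (lft j) p))).
apply: Cdiff_on_eq (Cdiff_onD Aop (Cdiff_on_ycoord Aop ord_max p)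
  (Cdiff_onM Aop (Cdiff_on_cst Aop p (-1)) S)) => // z _.
rewrite /varrho mulN1r; congr (_ - _); apply: eq_bigr => j _.
by rewrite !mxE.
Qed.

Lemma siegel_open : open (@siegel R m).
Proof.
apply: (@open_comp _ _ (@varrho R m) [set r | 0 < r]); last exact: open_gt.
by move=> z _; exact: (Cdiff_on_varrho 0%N openT).
Qed.

Local Notation K := (smooth_fun siegel_open).
Local Notation emb := (emb siegel_open).
Local Notation I := (imag_fun siegel_open).
Local Notation xf := (xfun siegel_open).
Local Notation yf := (yfun siegel_open).
Local Notation Dx := (@dx_fun _ _ _ siegel_open).
Local Notation Dy := (@dy_fun _ _ _ siegel_open).

Let Cdiff_rho p := Cdiff_on_varrho p siegel_open.
Let rho_gt0 (z : Cn) (Sz : siegel z) : 0 < varrho z := Sz.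

Local Notation pw := (pow_fun siegel_open Cdiff_rho rho_gt0).
Local Notation d := (Dy ord_max).
Local Notation t := (Dx ord_max).

(** Cartesian form of the field: [d] is d/dy_n, which coincides with d_rho, and [t] is d/dx_n, which
    coincides with T. The middle term comes from holding rho fixed. *)
Definition X_fun j (f : K) : K :=
  Dx (lft j) f + 2 * xf (lft j) * d f + 2 * yf (lft j) * t f.
Definition Y_fun j (f : K) : K :=
  Dy (lft j) f + 2 * yf (lft j) * d f + - (2 * xf (lft j)) * t f.
Definition L0_fun (f : K) : K :=
  - emb 4^-1 * \sum_j (X_fun j (X_fun j f) + Y_fun j (Y_fun j f)).

Let derivation_X j : derivation (X_fun j).
Proof.
apply: derivation_add; last exact/derivation_scale/derivation_dx.
apply: derivation_add; first exact: derivation_dx.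
exact/derivation_scale/derivation_dy.
Qed.

Let derivation_Y j : derivation (Y_fun j).
Proof.
apply: derivation_add; last exact/derivation_scale/derivation_dx.
apply: derivation_add; first exact: derivation_dy.
exact/derivation_scale/derivation_dy.
Qed.

Let Dx_const j c : Dx j (const_fun siegel_open c) = 0.
Proof. exact: diff_const_fun. Qed.

Let Dy_const j c : Dy j (const_fun siegel_open c) = 0.
Proof. exact: diff_const_fun. Qed.

(** A function killed by all the fields behaves as a constant for [L0_fun]; this covers complex
    constants and powers of rho alike. *)
Let L0_scale g : (forall j, X_fun j g = 0) -> (forall j, Y_fun j g = 0) ->
  forall f, L0_fun (g * f) = g * L0_fun f.
Proof.
move=> Xg Yg f; rewrite /L0_fun mulrCA; congr (_ * _); rewrite mulr_sumr.
apply: eq_bigr => j _; rewrite !(derivationM (derivation_X j)) Xg !mul0r !add0r.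
rewrite (derivationM (derivation_X j)) Xg mul0r add0r.
rewrite (derivationM (derivation_Y j)) Yg mul0r add0r.
by rewrite (derivationM (derivation_Y j)) Yg mul0r add0r [RHS]mulrDr.
Qed.

Let X_const j c : X_fun j (const_fun siegel_open c) = 0.
Proof. by rewrite /X_fun !(Dx_const, Dy_const) !(mulr0, addr0). Qed.

Let Y_const j c : Y_fun j (const_fun siegel_open c) = 0.
Proof. by rewrite /Y_fun !(Dx_const, Dy_const) !(mulr0, addr0). Qed.

Let L0D f g : L0_fun (f + g) = L0_fun f + L0_fun g.
Proof.
rewrite /L0_fun -mulrDr -big_split /=; congr (_ * _); apply: eq_bigr => j _.
rewrite (derivationD (derivation_X j) f g) (derivationD (derivation_Y j) f g).
rewrite (derivationD (derivation_X j) (X_fun j f)).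
by rewrite (derivationD (derivation_Y j) (Y_fun j f)) addrACA.
Qed.

Let rhoE : pw 1 = yf ord_max - \sum_j (xf (lft j) * xf (lft j) + yf (lft j) * yf (lft j)).
Proof.
rewrite pow_fun1; apply: smooth_funP => a.
rewrite smooth_funD smooth_funN smooth_fun_sum !real_funE.
rewrite /varrho rmorphB rmorph_sum; congr (_ - _).
apply: eq_bigr => j _; rewrite !mxE smooth_funD !smooth_funM !real_funE.
by rewrite -!rmorphM -rmorphD !expr2.
Qed.

Let two_delta (F : 'I_m -> K) j :
  \sum_k ((lft k == lft j)%:R * F k + F k * (lft k == lft j)%:R) = 2 * F j.
Proof.
rewrite -[RHS](sum_delta (fun k => 2 * F k)); apply: eq_bigr => k _.
by rewrite (inj_eq lift_inj); ring.
Qed.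

Let sumD (D : K -> K) (dD : derivation D) : D (pw 1) = D (yf ord_max) -
  \sum_j (D (xf (lft j)) * xf (lft j) + xf (lft j) * D (xf (lft j)) +
   (D (yf (lft j)) * yf (lft j) + yf (lft j) * D (yf (lft j)))).
Proof.
rewrite rhoE (derivationD dD) (derivationN dD) (derivation_sum dD).
congr (_ - _); apply: eq_bigr => j _.
by rewrite (derivationD dD) !(derivationM dD).
Qed.

Let lift_max (j : 'I_m) : (lft j == ord_max) = false.
Proof. by rewrite eq_sym; exact/negbTE/neq_lift. Qed.

Let max_lift (j : 'I_m) : (ord_max == lft j) = false.
Proof. exact/negbTE/neq_lift. Qed.

Let d_rho : d (pw 1) = 1.
Proof.
rewrite sumD; last exact: derivation_dy.
rewrite dy_yfun eqxx mulr1n big1 ?subr0 // => j _.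
by rewrite dy_xfun dy_yfun lift_max mulr0n; ring.
Qed.

Let t_rho : t (pw 1) = 0.
Proof.
rewrite sumD; last exact: derivation_dx.
rewrite dx_yfun big1 ?subr0 // => j _.
by rewrite dx_xfun dx_yfun lift_max mulr0n; ring.
Qed.

Let Dx_rho j : Dx (lft j) (pw 1) = - (2 * xf (lft j)).
Proof.
rewrite sumD; last exact: derivation_dx.
rewrite dx_yfun sub0r -(two_delta (fun k => xf (lft k)) j); congr (- _).
apply: eq_bigr => k _.
by rewrite dx_xfun dx_yfun; ring.
Qed.

Let Dy_rho j : Dy (lft j) (pw 1) = - (2 * yf (lft j)).
Proof.
rewrite sumD; last exact: derivation_dy.
rewrite dy_yfun max_lift mulr0n sub0r -(two_delta (fun k => yf (lft k)) j); congr (- _).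
apply: eq_bigr => k _.
by rewrite dy_xfun dy_yfun; ring.
Qed.

Let Dx_pw j s : Dx j (pw s) = emb s * pw (s - 1) * Dx j (pw 1).
Proof. by rewrite pow_fun1; exact: diff_pow_fun. Qed.

Let Dy_pw j s : Dy j (pw s) = emb s * pw (s - 1) * Dy j (pw 1).
Proof. by rewrite pow_fun1; exact: diff_pow_fun. Qed.

Let d_pw s : d (pw s) = emb s * pw (s - 1).
Proof. by rewrite Dy_pw d_rho mulr1. Qed.

Let t_pw s : t (pw s) = 0.
Proof. by rewrite Dx_pw t_rho mulr0. Qed.

(** The field is tangent to the level sets of rho: d/dx_j contributes -2 x_j, which cancels 2 x_j
    d_rho rho, and T rho = 0. *)
Let X_pw j s : X_fun j (pw s) = 0.
Proof. by rewrite /X_fun t_pw d_pw Dx_pw Dx_rho; ring. Qed.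

Let Y_pw j s : Y_fun j (pw s) = 0.
Proof. by rewrite /Y_fun t_pw d_pw Dy_pw Dy_rho; ring. Qed.

(** The coefficients of the fields involve z' only, so a derivation that kills z' and commutes with
    all Cartesian derivatives commutes with every field. This serves for d/dx_n and d/dy_n. *)
Let L0_commute (D : K -> K) (dD : derivation D) :
  (forall j f, D (Dx j f) = Dx j (D f)) -> (forall j f, D (Dy j f) = Dy j (D f)) ->
  (forall j, D (xf (lft j)) = 0) -> (forall j, D (yf (lft j)) = 0) ->
  (forall c, D (const_fun siegel_open c) = 0) ->
  forall f, L0_fun (D f) = D (L0_fun f).
Proof.
move=> DDx DDy Dxf Dyf Dc f.
have D2 : D 2 = 0 by rewrite -(rmorph_nat emb 2) Dc.
have DX j g : D (X_fun j g) = X_fun j (D g).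
  rewrite /X_fun !(derivationD dD) !(derivationM dD) D2 Dxf Dyf !(DDx, DDy).
  by ring.
have DY j g : D (Y_fun j g) = Y_fun j (D g).
  rewrite /Y_fun !(derivationD dD) !(derivationM dD) (derivationN dD).
  by rewrite !(derivationM dD) D2 Dxf Dyf !(DDx, DDy); ring.
rewrite /L0_fun (derivationM dD) (derivationN dD) Dc oppr0 mul0r add0r.
rewrite (derivation_sum dD); congr (_ * _); apply: eq_bigr => j _.
symmetry; apply: etrans (derivationD dD (X_fun j (X_fun j f)) (Y_fun j (Y_fun j f))) _.
apply: (congr2 +%R).
  by apply: etrans (DX j (X_fun j f)) _; congr (X_fun j _); exact: DX.
by apply: etrans (DY j (Y_fun j f)) _; congr (Y_fun j _); exact: DY.
Qed.

Let L0_d f : L0_fun (d f) = d (L0_fun f).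
Proof.
apply: L0_commute => [|j g|j g|j|j|c].
- exact: derivation_dy.
- exact: diff_funC.
- exact: diff_funC.
- exact: dy_xfun.
- by rewrite dy_yfun lift_max mulr0n.
- exact: Dy_const.
Qed.

Let L0_t f : L0_fun (t f) = t (L0_fun f).
Proof.
apply: L0_commute => [|j g|j g|j|j|c].
- exact: derivation_dx.
- exact: diff_funC.
- exact: diff_funC.
- by rewrite dx_xfun lift_max mulr0n.
- exact: dx_yfun.
- exact: Dx_const.
Qed.

Local Notation M := (siegelM emb pw I d t L0_fun).

Let represents_dx j : represents (dx j)
  (fun f => Dx (lft j) f + 2 * xf (lft j) * d f).
Proof.
move=> F f Ff a; have Sa : siegel (val a) by exact/set_mem/(valP a).
have sF := agree_smooth_on Ff.
rewrite /dx (coord_derive_curve siegel_open sF Sa (of_coords_dx j (val a))).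
rewrite (cderive_direction _ _ _ siegel_open sF Sa).
rewrite (represents_diff _ Ff) (represents_diff (basis_y ord_max) Ff).
by rewrite smooth_funD !smooth_funM smooth_fun_nat real_funE rmorphM rmorph_nat.
Qed.

Let represents_dy j : represents (dy j)
  (fun f => Dy (lft j) f + 2 * yf (lft j) * d f).
Proof.
move=> F f Ff a; have Sa : siegel (val a) by exact/set_mem/(valP a).
have sF := agree_smooth_on Ff.
rewrite /dy (coord_derive_curve siegel_open sF Sa (of_coords_dy j (val a))).
rewrite (cderive_direction _ _ _ siegel_open sF Sa).
rewrite (represents_diff _ Ff) (represents_diff (basis_y ord_max) Ff).
by rewrite smooth_funD !smooth_funM smooth_fun_nat real_funE rmorphM rmorph_nat.
Qed.

Let represents_T : represents T t.
Proof.
move=> F f Ff a; have Sa : siegel (val a) by exact/set_mem/(valP a).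
have sF := agree_smooth_on Ff.
rewrite /T (coord_derive_curve siegel_open sF Sa (of_coords_dt (val a))).
exact: represents_diff.
Qed.

Let represents_drho : represents drho d.
Proof.
move=> F f Ff a; have Sa : siegel (val a) by exact/set_mem/(valP a).
have sF := agree_smooth_on Ff.
rewrite /drho (coord_derive_curve siegel_open sF Sa (of_coords_drho (val a))).
exact: represents_diff.
Qed.

Let represents_X j : represents (X j) (X_fun j).
Proof.
move=> F f Ff a; rewrite /X (represents_dx j Ff) (represents_T Ff) /X_fun.
rewrite !smooth_funD !smooth_funM smooth_fun_nat !real_funE.
by rewrite /ycoord /zprime !mxE.
Qed.

Let represents_Y j : represents (Y j) (Y_fun j).
Proof.
move=> F f Ff a; rewrite /Y (represents_dy j Ff) (represents_T Ff) /Y_fun.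
rewrite !smooth_funD !smooth_funM smooth_funN !smooth_funM smooth_fun_nat !real_funE.
by rewrite /xcoord /zprime !mxE mulNr.
Qed.

Let represents_L0 : represents L0 L0_fun.
Proof.
move=> F f Ff a; rewrite /L0 /L0_fun smooth_funM smooth_funN emb_val fmorphV rmorph_nat.
rewrite smooth_fun_sum; congr (_ * _); apply: eq_bigr => j _.
rewrite smooth_funD.
by rewrite (represents_X j (represents_X j Ff)) (represents_Y j (represents_Y j Ff)).
Qed.

Theorem siegel_factorization (a : R) k (u : Cn -> R[i]) :
  smooth_on siegel u -> forall z : Cn, siegel z ->
  prod_op k (fun j v w =>
      (varrho w)%:C * drho (drho v) w + a%:C * drho v w
      + (varrho w)%:C * T (T v) w - L0 v w
      - 'i%C * (k%:R + 1 - 2 * j%:R) * T v w)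
    (fun w => (varrho w `^ ((k%:R - m.+1%:R - a) / 2))%:C * u w) z
  = 4 ^- k * (varrho z `^ (- ((k%:R + m.+1%:R + a) / 2)))%:C
    * prod_op k (fun j v w =>
        siegel_laplacian v w
        + (m.+1%:R ^+ 2 - (a%:C - k%:R + 2 * j%:R - 2) ^+ 2) * v w) u z.
Proof.
move=> su z Sz; pose b : siegel := exist _ z (mem_set Sz).
set P := fun j : nat => _; set Q := fun j : nat => _ : operator _.
have PM : represents (prod_op k P) (comp_range (fun j =>
    M ((a - (k%:R + 1 - 2 * j%:R)) / 2) ((a + (k%:R + 1 - 2 * j%:R)) / 2)) 1 k.+1).
  apply: represents_prod => j F h Fh b'; rewrite /P.
  have dF := represents_drho Fh; have tF := represents_T Fh.
  rewrite (represents_drho dF) (represents_T tF) dF tF (represents_L0 Fh).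
  rewrite /siegelM pow_fun1; set c : R := k%:R + 1 - 2 * j%:R.
  (* The sum p + q = a is the coefficient of d_rho, and p - q = -c gives the term -icT. *)
  have -> : (a - c) / 2 + (a + c) / 2 = a by field.
  have -> : (a - c) / 2 - (a + c) / 2 = - c by field.
  have -> : (k%:R + 1 - 2 * j%:R : R[i]) = c%:C.
    by rewrite /c !(rmorphB, rmorphD, rmorphM, rmorph_nat, rmorph1).
  rewrite !(smooth_funD, smooth_funN, smooth_funM, emb_val, real_funE) imag_fun_val.
  by rewrite rmorphN mulrN; congr (_ + _); rewrite mulNr.
have QM : represents (prod_op k Q) (comp_range (fun j => shifted_laplacian emb pw M
    ((1 - m.+1%:R) / 2) (m.+1%:R ^+ 2 - (a - k%:R + 2 * j%:R - 2) ^+ 2)) 1 k.+1).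
  apply: represents_prod => j F h Fh b'; rewrite /Q /siegel_laplacian.
  have dF := represents_drho Fh; have tF := represents_T Fh.
  rewrite (represents_drho dF) (represents_T tF) dF (Fh b') (represents_L0 Fh).
  rewrite /shifted_laplacian /siegelM pow_fun1 subrr rmorph0 mulr0 mul0r addr0.
  (* Now p + q = 1 - n, the coefficient of d_rho in Delta_B / (4 rho), and the T term has dropped
     out since p = q. *)
  have -> : (1 - m.+1%:R) / 2 + (1 - m.+1%:R) / 2 = 1 - m.+1%:R :> R by field.
  set c : R := m.+1%:R ^+ 2 - _.
  have -> : (m.+1%:R ^+ 2 - (a%:C - k%:R + 2 * j%:R - 2) ^+ 2 : R[i]) = c%:C.
    by rewrite /c !(rmorphB, rmorphD, rmorphXn, rmorphM, rmorph_nat, rmorph1).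
  move: (d (d h)) (t (t h)) (L0_fun h) (d h) => f1 f2 f3 f4.
  rewrite !(smooth_fun_nat, smooth_funD, smooth_funN, smooth_funM, emb_val, real_funE).
  have -> : (1 - m.+1%:R : R)%:C = 1 - m.+1%:R by rewrite rmorphB rmorph_nat rmorph1.
  by ring.
have Pu : agree (fun w => (varrho w `^ ((k%:R - m.+1%:R - a) / 2))%:C * u w)
    (pw ((k%:R - m.+1%:R - a) / 2) * smooth_restrict siegel_open su) by [].
rewrite -[z]/(val b) (PM _ _ Pu) (QM _ _ (agree_smooth_restrict _ su)).
have tE c : t (emb c) = 0 by exact: Dx_const.
have dE c : d (emb c) = 0 by exact: Dy_const.
have LE c f : L0_fun (emb c * f) = emb c * L0_fun f.
  by apply: L0_scale => j; [exact: X_const|exact: Y_const].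
rewrite (@factorization R K emb pw M _ _ _ _ _ ((1 - m.+1%:R) / 2) m.+1%:R a k) //.
- by rewrite !smooth_funM emb_val real_funE fmorphV rmorphXn rmorph_nat mulrA.
- exact: pow_funD.
- exact: (siegelMD _ _ _ (derivation_dy _ _) (derivation_dx _ _) L0D).
- exact: (siegelMZ _ _ (derivation_dy _ _) (derivation_dx _ _) LE dE tE).
- apply: (siegelM_exchange (imag_fun2 _) (derivation_dy _ _) (derivation_dx _ _)
    _ L0D _ LE L0_d L0_t dE tE (Dy_const _ _) (Dx_const _ _) d_pw t_pw (pow_fun0 _ _ _)).
    by move=> f; exact: diff_funC.
  by move=> f; apply: L0_scale => j; [exact: X_const|exact: Y_const].
- exact: (siegelM_pw I (pow_funD _ _ _) (derivation_dy _ _) (derivation_dx _ _)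
    (fun s => L0_scale (fun j => X_pw j s) (fun j => Y_pw j s)) dE d_pw t_pw (pow_fun0 _ _ _)).
Qed.

End SiegelModel.

Theorem theorem1p3 (R : realType) (m : nat) (a : R) (k : nat) :
  let n := m.+1 in
  (2 <= n)%N -> (0 < k)%N ->
  (forall u : Cspace R n -> R[i], smooth_on siegel u ->
    forall z : Cspace R n, siegel z ->
    prod_op k (fun j v w =>
        (varrho w)%:C * drho (drho v) w + a%:C * drho v w
        + (varrho w)%:C * T (T v) w - L0 v w
        - 'i%C * (k%:R + 1 - 2 * j%:R) * T v w)
      (fun w => (varrho w `^ ((k%:R - n%:R - a) / 2))%:C * u w) z
    = 4 ^- k * (varrho z `^ (- ((k%:R + n%:R + a) / 2)))%:C
      * prod_op k (fun j v w =>
          siegel_laplacian v w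
          + (n%:R ^+ 2 - (a%:C - k%:R + 2 * j%:R - 2) ^+ 2) * v w) u z)
  /\
  (forall f : Cspace R n -> R[i], smooth_on ball_dom f ->
    forall z : Cspace R n, ball_dom z ->
    prod_op k (fun j v w =>
        Delta' ((1 - a%:C - n%:R) / 2) ((1 - a%:C - n%:R) / 2) v w
        + (k%:R + 1 - 2 * j%:R) ^+ 2 / 4 * v w
        - (k%:R + 1 - 2 * j%:R) / 2 * (radial v w - radial_bar v w))
      (fun w => ((1 - normsq w) `^ ((k%:R - n%:R - a) / 2))%:C * f w) z
    = 4 ^- k * ((1 - normsq z) `^ (- ((k%:R + n%:R + a) / 2)))%:C
      * prod_op k (fun j v w =>
          ball_laplacian v w
          + (n%:R ^+ 2 - (a%:C - k%:R + 2 * j%:R - 2) ^+ 2) * v w) f z).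
Proof.
by move=> n _ _; split; [exact: siegel_factorization|exact: ball_factorization].
Qed.
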